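(* Let $N\ge 1$ be a fixed integer, and let $1<p<m$, $\sigma>0$ and $r_0>0$. There exists a constant $C_*>0$, depending on $m$ and $r_0$, such that the following holds for every $C_0\ge C_*$. Let $u_0\in C(\mathbb{R}^N)$ be non-negative, radially symmetric, compactly supported and not identically zero, and let $u$ be the (radially symmetric) solution to the Cauchy problem $$\partial_t u=\Delta u^m+|x|^{\sigma}u^p,\qquad u(x,0)=u_0(x),\quad x\in\mathbb{R}^N,$$ with blow-up time $T(u_0)\in(0,\infty)$. Assume that $u$ blows up at time $t=T(u_0)$ at any point $x\in\mathbb{R}^N$ with $|x|=r_0$, with $$\lim_{t\to T(u_0)}(T(u_0)-t)^{1/(m-1)}u(r_0,t)\ge C_0,$$ where $u(r_0,t)$ denotes the common value of $u(x,t)$ for $|x|=r_0$. Then $B(u)=\mathbb{R}^N$, that is, every point of $\mathbb{R}^N$ is a blow-up point of $u$.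
   Context: Solution: a non-negative function $u$ is a (weak) solution to the Cauchy problem in $Q_T=\mathbb{R}^N\times(0,T)$ if $u\in C(\mathbb{R}^N\times(0,t))$ for any $t\in(0,T)$ and if, for any bounded domain $\Omega\subset\mathbb{R}^N$ (with boundary regular enough for the boundary integral below to make sense, outward unit normal $n$) and any test function $\varphi\in C^{2,1}(\overline{\Omega}\times[0,T))$ with $\varphi=0$ on $\partial\Omega\times(0,T)$, one has for any $t\in(0,T)$ $$\int_{\Omega}u(x,t)\varphi(x,t)\,dx-\int_{\Omega}u_0(x)\varphi(x,0)\,dx=\int_0^t\!\int_{\Omega}\left(u\,\partial_s\varphi+u^m\Delta\varphi+|x|^{\sigma}u^p\varphi\right)dx\,ds-\int_0^t\!\int_{\partial\Omega}u^m\,\partial_n\varphi\,dS\,ds.$$ Blow-up time: writing $u(t)$ for the map $x\mapsto u(x,t)$, it is the time $T=T(u_0)\in(0,\infty)$ such that $u(t)\in L^\infty(\mathbb{R}^N)$ for any $t\in(0,T)$, but $u(T)\notin L^\infty(\mathbb{R}^N)$ (so that $u$ becomes unbounded as $t\to T$). Blow-up point and blow-up set: a point $x\in\mathbb{R}^N$ is a blow-up point of $u$ if there is a sequence $(x_k,t_k)_{k\ge1}$ in $Q_T$, with $T=T(u_0)$, such that $x_k\to x$, $t_k\to T$ and $u(x_k,t_k)\to\infty$ as $k\to\infty$. The blow-up set $B(u)$ is the set of blow-up points of $u$. Standing known facts (from earlier literature): for $1<p<m$, $\sigma>0$ and $u_0$ as in the claim, the Cauchy problem is well-posed (the solution is unique),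 the solution is radially symmetric in $x$, it blows up at a finite time $T(u_0)\in(0,\infty)$, and $u(t)$ is compactly supported for any $t\in(0,T(u_0))$. *)

(* Defs.v *)
From HB Require Import structures.
From mathcomp Require Import all_boot all_order all_algebra.
From mathcomp Require Import all_classical all_reals all_analysis.

Set Implicit Arguments.
Unset Strict Implicit.
Unset Printing Implicit Defensive.

Import Order.TTheory GRing.Theory Num.Theory.
Import numFieldNormedType.Exports.

Local Open Scope classical_set_scope.
Local Open Scope ring_scope.

(* R^N is 'rV[R]_N.  Its library norm `|x| is the sup norm, which gives the
   usual topology; lengths are measured with the Euclidean norm below. *)
Definition dotv (R : realType) N (x y : 'rV[R]_N) : R :=
  \sum_(i < N) x ord0 i * y ord0 i.

Definition enorm (R : realType) N (x : 'rV[R]_N) : R := Num.sqrt (dotv x x).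

Definition radial (R : realType) N (f : 'rV[R]_N -> R) : Prop :=
  forall x y, enorm x = enorm y -> f x = f y.

(* N-dimensional Lebesgue measure, as the iterated product of the measure on R.
   The library puts the product sigma-algebra on N.-tuple R, not on 'rV[R]_N,
   so the measure lives on tuples and is transported along tvec. *)
Section lebesgue_tuple.
Variable R : realType.
Local Notation T := (measurableTypeR R).

Definition consp n (p : n.-tuple T * T) : n.+1.-tuple T :=
  [the n.+1.-tuple T of p.2 :: p.1].

Lemma measurable_consp n : measurable_fun [set: n.-tuple T * T] (@consp n).
Proof. by apply: measurable_cons. Qed.

(* The canonical measure structure of pushforward, applied by name because
   unification cannot find the measurability proof. *)
Fixpoint lebesgue_tuple n : {measure set (n.-tuple T) -> \bar R} :=
  match n with
  | 0%N => [the measure _ _ of \d_([tuple] : 0.-tuple T)]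
  | k.+1 => measure_function_pushforward__canonical__measure_function_Measure
              [the measure _ _ of (lebesgue_tuple k \x lebesgue_measure)%E]
              (@measurable_consp k)
  end.

End lebesgue_tuple.

Definition tvec (R : realType) N (y : N.-tuple (measurableTypeR R)) : 'rV[R]_N :=
  \row_(i < N) tnth y i.

Definition spaceint (R : realType) N (D : set 'rV[R]_N) (f : 'rV[R]_N -> R) : R :=
  \int[lebesgue_tuple R N]_(y in [set y | D (tvec y)]) f (tvec y).

Definition Linfty_norm (R : realType) N (f : 'rV[R]_N -> R) : \bar R :=
  ('N[lebesgue_tuple R N]_+oo [ (fun y => (f (tvec y))%:E) ])%E.

Definition outer_measure_measure (R : realType) (T : pointedType)
    (mu : {outer_measure set T -> \bar R}) :
    {measure set (caratheodory_type mu) -> \bar R} :=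
  [the measure _ _ of (mu : set (caratheodory_type mu) -> \bar R)].

(* Surface measure: the k-dimensional Hausdorff measure of the Euclidean space
   'rV[R]_N, normalized by the volume of the unit ball of R^k so that on
   k-dimensional C^1 submanifolds it is the usual surface measure (and the
   counting measure for k = 0). *)
Section hausdorff_measure.
Variables (R : realType) (N k : nat).
Local Notation V := 'rV[R]_N.

Definition ediam (A : set V) : \bar R :=
  Order.max 0%E
    (ereal_sup [set (enorm (x - y))%:E | x in A & y in A]).

Definition unit_ball_volume (n : nat) : R :=
  fine (lebesgue_tuple R n [set y | enorm (tvec y) <= 1]).

(* The value +oo on sets of diameter > delta restricts the coverings used by
   mu_ext to sets of diameter <= delta. *)
Definition hausdorff_gauge (delta : R) (A : set V) : \bar R :=
  if A == set0 then 0%E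
  else if (ediam A <= delta%:E)%E then
    (unit_ball_volume k * (fine (ediam A) / 2) ^+ k)%:E
  else +oo%E.

(* Every set is measurable here, so mu_ext ranges over arbitrary countable
   coverings. *)
Definition hausdorff_pre (delta : R) : set V -> \bar R :=
  @mu_ext _ (g_sigma_algebraType [set: set V]) R (hausdorff_gauge delta).

Definition hausdorff (A : set V) : \bar R :=
  ereal_sup [set hausdorff_pre delta A | delta in [set d : R | 0 < d]].

Lemma hausdorff_gauge0 delta : hausdorff_gauge delta set0 = 0%E.
Proof. by rewrite /hausdorff_gauge eqxx. Qed.

Lemma hausdorff_gauge_ge0 delta A : (0 <= hausdorff_gauge delta A)%E.
Proof.
rewrite /hausdorff_gauge; case: ifPn => // _; case: ifPn => // _.
rewrite lee_fin mulr_ge0//; first by apply: fine_ge0; exact: measure_ge0.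
rewrite exprn_ge0// divr_ge0// fine_ge0// /ediam.
by rewrite le_max lexx.
Qed.

Lemma hausdorff0 : hausdorff set0 = 0%E.
Proof.
rewrite /hausdorff (_ : [set _ | _ in _] = [set 0%E]) ?ereal_sup1//.
have H (d : R) : hausdorff_pre d set0 = 0%E.
  by apply: mu_ext0 => [|X]; [exact: hausdorff_gauge0|exact: hausdorff_gauge_ge0].
apply/seteqP; split => [_ [d _ <-]|_ ->] /=; first exact: H.
by exists 1 => //=; exact: ltr01.
Qed.

Lemma hausdorff_ge0 A : (0 <= hausdorff A)%E.
Proof.
apply: (@le_trans _ _ (hausdorff_pre 1 A)).
  by apply: mu_ext_ge0 => X; exact: hausdorff_gauge_ge0.
by apply: ereal_sup_ubound; exists 1 => //=; exact: ltr01.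
Qed.

Lemma le_hausdorff : {homo hausdorff : A B / A `<=` B >-> (A <= B)%E}.
Proof.
move=> A B AB; apply: ge_ereal_sup => _ [d d0 <-].
apply: (@le_trans _ _ (hausdorff_pre d B)); first exact: le_mu_ext.
by apply: ereal_sup_ubound; exists d.
Qed.

Lemma hausdorff_sigma_subadditive : sigma_subadditive hausdorff.
Proof.
move=> F; apply: ge_ereal_sup => _ [d d0 <-].
have ge0 X : (0 <= hausdorff_gauge d X)%E by exact: hausdorff_gauge_ge0.
apply: (@le_trans _ _ (\sum_(i <oo) hausdorff_pre d (F i))%E).
  apply: (@mu_ext_sigma_subadditive _ (g_sigma_algebraType [set: set V]) R) => //.
apply: lee_nneseries => [i _ _|i _]; first exact: mu_ext_ge0.
by apply: ereal_sup_ubound; exists d.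
Qed.

HB.instance Definition _ := isOuterMeasure.Build R V hausdorff
  hausdorff0 hausdorff_ge0 le_hausdorff hausdorff_sigma_subadditive.

Definition hausdorff_measure :=
  outer_measure_measure [the {outer_measure set V -> \bar R} of hausdorff].

End hausdorff_measure.

Definition bdry (R : realType) N (Omega : set 'rV[R]_N) : set 'rV[R]_N :=
  closure Omega `\` interior Omega.

Definition surfint (R : realType) N (Omega : set 'rV[R]_N) (f : 'rV[R]_N -> R) : R :=
  \int[hausdorff_measure R N N.-1]_(x in bdry Omega) f x.

Definition bounded_domain (R : realType) N (Omega : set 'rV[R]_N) : Prop :=
  [/\ open Omega, connected Omega, Omega !=set0 & bounded_set Omega].

Definition basis_vec (R : realType) N (i : 'I_N) : 'rV[R]_N := delta_mx ord0 i.

Definition grad (R : realType) N (f : 'rV[R]_N -> R) (x : 'rV[R]_N) : 'rV[R]_N :=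
  \row_(i < N) 'D_(basis_vec R i) f x.

(* Omega has a C^1 boundary and outward unit normal nu on it: locally Omega is
   {rho < 0} with rho of class C^1 and grad rho <> 0. *)
Definition C1_boundary_normal (R : realType) N (Omega : set 'rV[R]_N)
    (nu : 'rV[R]_N -> 'rV[R]_N) : Prop :=
  forall x0, bdry Omega x0 ->
  exists (U : set 'rV[R]_N) (rho : 'rV[R]_N -> R),
    [/\ open U /\ U x0,
        forall x, U x ->
          [/\ differentiable rho x, {for x, continuous (grad rho)}
             & grad rho x != 0],
        forall x, U x -> (Omega x <-> rho x < 0)
      & forall x, U x -> bdry Omega x ->
          nu x = (enorm (grad rho x))^-1 *: grad rho x].

Definition continuous_on (R : realType) N (W : topologicalType)
    (D : set ('rV[R]_N * R)) (f : 'rV[R]_N -> R -> W) : Prop :=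
  {within D, continuous (fun z => f z.1 z.2)}.

(* phi in C^{2,1}(closure Omega x [0,T)): the derivatives phi_t, D phi, D^2 phi
   exist in Omega x (0,T) and extend continuously to closure Omega x [0,T); the
   arguments phit, Dphi, D2phi are these (uniquely determined) extensions. *)
Record C21 (R : realType) N (Omega : set 'rV[R]_N) (T : R)
    (phi phit : 'rV[R]_N -> R -> R) (Dphi : 'rV[R]_N -> R -> 'rV[R]_N)
    (D2phi : 'rV[R]_N -> R -> 'M[R]_N) : Prop := {
  C21_cont : continuous_on (closure Omega `*` `[0, T[) phi ;
  C21_cont_t : continuous_on (closure Omega `*` `[0, T[) phit ;
  C21_cont_D : continuous_on (closure Omega `*` `[0, T[) Dphi ;
  C21_cont_D2 : continuous_on (closure Omega `*` `[0, T[) D2phi ;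
  C21_t : forall x t, Omega x -> 0 < t < T -> is_derive t 1 (phi x) (phit x t) ;
  C21_D : forall x t i, Omega x -> 0 < t < T ->
    is_derive x (basis_vec R i) (phi ^~ t) (Dphi x t ord0 i) ;
  C21_D2 : forall x t i j, Omega x -> 0 < t < T ->
    is_derive x (basis_vec R i) (fun y => Dphi y t ord0 j) (D2phi x t i j) }.

Definition pde_flux (R : realType) N (m p sigma : R) (Omega : set 'rV[R]_N)
    (u phi phit : 'rV[R]_N -> R -> R) (D2phi : 'rV[R]_N -> R -> 'M[R]_N)
    (s : R) : R :=
  spaceint Omega (fun x =>
    u x s * phit x s + u x s `^ m * \tr (D2phi x s)
    + enorm x `^ sigma * u x s `^ p * phi x s).

Definition bdry_flux (R : realType) N (m : R) (Omega : set 'rV[R]_N)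
    (nu : 'rV[R]_N -> 'rV[R]_N) (u : 'rV[R]_N -> R -> R)
    (Dphi : 'rV[R]_N -> R -> 'rV[R]_N) (s : R) : R :=
  surfint Omega (fun x => u x s `^ m * dotv (Dphi x s) (nu x)).

(* Weak solution in R^N x (0,T).  As continuity of u is not required down to
   t = 0, integrability in time, which gives a meaning to the time integrals,
   is stated explicitly; the space integrals are those of functions continuous
   on compact sets. *)
Record weak_solution (R : realType) N (m p sigma : R) (u0 : 'rV[R]_N -> R)
    (T : R) (u : 'rV[R]_N -> R -> R) : Prop := {
  weak_ge0 : forall x t, 0 < t < T -> 0 <= u x t ;
  weak_cont : forall t, 0 < t < T -> continuous_on (setT `*` `]0, t[) u ;
  weak_eq : forall Omega nu phi phit Dphi D2phi,
    bounded_domain Omega -> C1_boundary_normal Omega nu ->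
    C21 Omega T phi phit Dphi D2phi ->
    (forall x s, bdry Omega x -> 0 < s < T -> phi x s = 0) ->
    forall t, 0 < t < T ->
    let mu := @lebesgue_measure R in
    let F := pde_flux m p sigma Omega u phi phit D2phi in
    let G := bdry_flux m Omega nu u Dphi in
    [/\ mu.-integrable `]0, t[ (EFin \o F), mu.-integrable `]0, t[ (EFin \o G)
      & spaceint Omega (fun x => u x t * phi x t)
        - spaceint Omega (fun x => u0 x * phi x 0)
        = \int[mu]_(s in `]0, t[) F s - \int[mu]_(s in `]0, t[) G s] }.

(* u is only defined for t < T, so "u(T) is not in L^oo" is expressed as: the
   L^oo norm of u(t) is not bounded as t -> T. *)
Definition blowup_time (R : realType) N (u : 'rV[R]_N -> R -> R) (T : R) : Prop :=
  [/\ 0 < T,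
      forall t, 0 < t < T -> (Linfty_norm (u ^~ t) < +oo)%E
    & forall M e : R, 0 < e ->
        exists2 t, 0 < t < T /\ T - e < t & (M%:E < Linfty_norm (u ^~ t))%E].

Definition blowup_point (R : realType) N (u : 'rV[R]_N -> R -> R) (T : R)
    (x : 'rV[R]_N) : Prop :=
  exists (xs : nat -> 'rV[R]_N) (ts : nat -> R),
    [/\ forall k, 0 < ts k < T, xs @ \oo --> x, ts @ \oo --> T
      & (fun k => u (xs k) (ts k)) @ \oo --> +oo].

Definition blowup_set (R : realType) N (u : 'rV[R]_N -> R -> R) (T : R)
    : set 'rV[R]_N := [set x | blowup_point u T x].

(* Main.v *)
(* Fix 0 < t1 < T and put W(x,t) = \int_t1^t u^m ds, P(x,t) = \int_t1^t u^p ds, so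
   that Delta W = u(t) - u(t1) - |x|^sigma P in the weak sense.  Hence, if a
   paraboloid al |x|^2 + b touches W(.,t) from below (above) at a, then
   u(a,t) - u(a,t1) - |a|^sigma P(a,t) is at least (at most) 2 N al.
   Inside |x| <= r0, choose al with (2 N al)^m > (al r0^2 + 1) / (m - 1) and
   compare W with tau(t) (al |x|^2 + 1) - tau(t1) (al r0^2 + 1), where
   tau(t) = (T - t)^(-1/(m-1)): at a space-time minimum of the difference with
   t > t1 the touching property, or the assumed blow-up rate when |x| = r0, gives
   u >= 2 N al tau, so that W grows strictly faster than the barrier in time.
   Thus W(x,t) tends to infinity as t -> T for |x| <= r0, which excludes that
   u(x,.) is bounded.
   If u were bounded on |x| = rho > r0, then, since u^p <= eps u^m + C, touching
   W(.,t) from above by a large concave paraboloid would bound W on |x| <= rho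
   uniformly in t, a contradiction. *)

Require Import Defs.
From HB Require Import structures.
From mathcomp Require Import all_boot all_order all_algebra.
From mathcomp Require Import all_classical all_reals all_analysis measurable_realfun.
From mathcomp Require Import ring lra.
Import Order.TTheory GRing.Theory Num.Theory.
Import numFieldNormedType.Exports.
Local Open Scope classical_set_scope.
Local Open Scope ring_scope.
Set Implicit Arguments.
Unset Strict Implicit.
Unset Printing Implicit Defensive.

(** * Lebesgue measure on tuples *)

(** A weak solution is only continuous, so a classical comparison argument cannot be applied to u
    itself. The time integral W repairs this: it is C^1 in time with derivative u^m, and in space it
    satisfies a linear weak equation, of which only the one-sided inequality at a touching point is
    used. That inequality comes from testing on balls with cubes of truncated paraboloids: their
    gradient vanishes on the sphere, so the boundary term drops out, and the remaining integrals are
    handled by Fubini along coordinate lines. Starting at t1 > 0 keeps away from t = 0, where u is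
    not assumed continuous. The condition on al compares W_t = u^m >= (2 N al tau)^m with the time
    derivative tau^m (al |x|^2 + 1) / (m - 1) of the barrier; it involves only N, m and r0, hence so
    does C_*. In the outer bound the concavity must beat a source term that is itself controlled by
    the maximum of W; p < m leaves eps free, and a suitable eps closes this loop. *)

Lemma bigcup_countType_measurable d (Y : measurableType d) (I : countType)
    (D : set I) (F : I -> set Y) :
  (forall i, measurable (F i)) -> measurable (\bigcup_(i in D) F i).
Proof.
move=> mF.
rewrite (_ : bigcup _ _ = \bigcup_n
  (if @unpickle I n is Some i then [set y | D i /\ F i y] else set0)).
  apply: bigcupT_measurable => n; case: unpickle => [i|]; last exact: measurable0.
  have [Di|nDi] := pselect (D i).
    by rewrite (_ : mkset _ = F i)//; apply/seteqP; split => [y []|y].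
  rewrite (_ : mkset _ = set0); first exact: measurable0.
  by apply/seteqP; split => [y []|y].
apply/seteqP; split => [y [i Di Fiy]|y [n _]].
  by exists (pickle i) => //; rewrite pickleK.
by case: unpickle => // i [Di Fiy]; exists i.
Qed.

(** The sigma-algebra on tuples is generated by coordinates, while [f] is continuous for the
    topology of row vectors. The two meet because an open set is the countable union of the boxes
    with rational centre and half-side 1/(k+1) that it contains. *)
Lemma measurable_continuous_rV d (Y : measurableType d) (R : realType) N
    (e : Y -> 'rV[R]_N) (f : 'rV[R]_N -> R) :
  (forall i, measurable_fun setT (fun y => e y ord0 i)) -> continuous f ->
  measurable_fun setT (f \o e).
Proof.
move=> me cf.
apply: (measurability _ (RGenOpens.measurableE R)) => _ [_ [a [b ->]] <-].
rewrite setTI comp_preimage; set A := f @^-1` _.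
have oA : open A by move/continuousP : cf; apply; exact: interval_open.
pose box (qk : N.-tuple rat * nat) : set 'rV[R]_N :=
  [set x | forall i, ratr (tnth qk.1 i) - qk.2.+1%:R^-1 < x ord0 i
                     < ratr (tnth qk.1 i) + qk.2.+1%:R^-1 ].
rewrite (_ : e @^-1` A = \bigcup_(qk in [set qk | box qk `<=` A]) (e @^-1` (box qk))).
  apply: bigcup_countType_measurable => -[q k].
  rewrite (_ : _ @^-1` _ = \big[setI/setT]_(i < N)
     [set y | e y ord0 i \in `]ratr (tnth q i) - k.+1%:R^-1, ratr (tnth q i) + k.+1%:R^-1[]).
    apply: bigsetI_measurable => i _.
    have := me i measurableT _ (measurable_itv `]ratr (tnth q i) - k.+1%:R^-1,
      ratr (tnth q i) + k.+1%:R^-1[).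
    by rewrite setTI.
  apply/seteqP; split => [y|y]/=.
    move=> H; rewrite -bigcap_seq => i _ /=; have := H i.
    by rewrite in_itv.
  rewrite -bigcap_seq => H i; have := H i; rewrite /= mem_index_enum in_itv/=.
  exact.
apply/seteqP; split => [y /= Ay|y [qk /= qA]]; last exact: qA.
have [eps /= eps0 epsA] := (@nbhs_ballP _ _ _ _).1 (open_nbhs_nbhs (conj oA Ay)).
(* The box centre lies within 1/(k+1) of [e y], so every point of the box lies within 2/(k+1) < eps
   of it. *)
have [k keps] : exists k : nat, k.+1%:R^-1 < eps / 2.
  have e2 : 0 < eps / 2 by rewrite divr_gt0.
  exists (Num.truncn (eps / 2)^-1); rewrite invf_plt ?posrE//.
  exact: truncnS_gt.
have ex i : exists q : rat, e y ord0 i - k.+1%:R^-1 < ratr q < e y ord0 i + k.+1%:R^-1.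
  have : e y ord0 i - k.+1%:R^-1 < e y ord0 i + k.+1%:R^-1.
    by rewrite ltrBlDr -addrA ltrDl addr_gt0 ?invr_gt0.
  by move=> /rat_in_itvoo[q]; rewrite in_itv/= => qq; exists q.
pose q := [tuple sval (cid (ex i)) | i < N].
have qP i : e y ord0 i - k.+1%:R^-1 < ratr (tnth q i) < e y ord0 i + k.+1%:R^-1.
  by rewrite tnth_mktuple; case: cid.
exists (q, k) => /=.
  move=> x bx; apply: epsA; split => // i j; rewrite (_ : i = ord0) ?ord1//.
  have /andP[b1 b2] := bx j; have /andP[q1 q2] := qP j.
  rewrite /= in b1 b2.
  have H : - eps < e y ord0 j - x ord0 j < eps.
    apply/andP; move: keps q1 q2 b1 b2; move: (k.+1%:R^-1) => s.
    by split; lra.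
  by rewrite /ball/= ltr_norml.
move=> i /=; have /andP[q1 q2] := qP i.
by apply/andP; move: q1 q2; move: (k.+1%:R^-1) => s; split; lra.
Qed.

Lemma integrable_bounded_support d (Y : measurableType d) (R : realType)
    (mu : {measure set Y -> \bar R}) (A : set Y) (f : Y -> R) (M : R) :
  measurable A -> (mu A < +oo)%E -> measurable_fun setT f ->
  (forall y, `|f y| <= M) -> (forall y, ~ A y -> f y = 0) ->
  mu.-integrable setT (EFin \o f).
Proof.
move=> mA Aoo mf fM f0.
have -> : EFin \o f = (EFin \o f) \_ A.
  apply/funext => y; rewrite /patch; case: ifPn => //= /negP.
  by rewrite inE => /f0 ->.
rewrite -integrable_mkcond//; apply: measurable_bounded_integrable => //.
  exact: measurable_funTS.
by exists M; split; [exact: num_real|move=> K MK y _ /=; apply: le_trans (fM y) _; exact: ltW].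
Qed.

Definition cube (R : realType) N (a : 'I_N -> R) (L : R) :
    set (N.-tuple (measurableTypeR R)) :=
  [set y | forall i, a i - L <= tnth y i <= a i + L].

Definition updt (R : realType) N (y : N.-tuple (measurableTypeR R)) (i : 'I_N) (s : R) :
    N.-tuple (measurableTypeR R) :=
  [tuple (if j == i then s else tnth y j) | j < N].

Section lebesgue_tuple_theory.
Variable R : realType.
Local Notation T := (measurableTypeR R).
Local Notation lambda := (@lebesgue_measure R).

Lemma measurable_cube N (a : 'I_N -> R) L : measurable (cube a L).
Proof.
rewrite (_ : cube a L = \big[setI/setT]_(i < N)
     [set y | tnth y i \in `[a i - L, a i + L]]).
  apply: bigsetI_measurable => i _.
  have := @measurable_tnth _ T N i measurableT _ (measurable_itv `[a i - L, a i + L]).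
  by rewrite setTI.
apply/seteqP; split => [y|y]/=.
  move=> H; rewrite -bigcap_seq => i _ /=; have := H i.
  by rewrite in_itv.
rewrite -bigcap_seq => H i; have := H i; rewrite /= mem_index_enum in_itv/=.
exact.
Qed.

Lemma lebesgue_tuple_cube N (a : 'I_N -> R) L : 0 <= L ->
  lebesgue_tuple R N (cube a L) = ((L *+ 2) ^+ N)%:E.
Proof.
move=> L0; elim: N a => [|N IH] a.
  by rewrite /= diracE mem_set// => -[].
rewrite /= /pushforward.
rewrite (_ : _ @^-1` _ = cube (fun i => a (lift ord0 i)) L `*` `[a ord0 - L, a ord0 + L]).
  rewrite product_measure1E//; last exact: measurable_cube.
  have E : lambda `[a ord0 - L, a ord0 + L]%classic = (L *+ 2)%:E.
    rewrite lebesgue_measure_itv/= lte_fin.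
    case: ifPn => [_|]; first by rewrite -EFinB; congr (_%:E); ring.
    by rewrite -leNgt => h; congr (_%:E); lra.
  rewrite exprSr EFinM; congr (_ * _)%E; last exact: E.
  exact: IH.
apply/seteqP; split => [[t h]|[t h]] /=.
  move=> H; split => /= [i|].
    by have := H (lift ord0 i); rewrite tnthS.
  by have := H ord0; rewrite in_itv.
move=> [H1]; rewrite in_itv/= => H2 i.
by case: (unliftP ord0 i) => [j ->|->]; [rewrite tnthS; exact: H1|exact: H2].
Qed.

Lemma lebesgue_tuple_cube_lty N (a : 'I_N -> R) L :
  (lebesgue_tuple R N (cube a L) < +oo)%E.
Proof.
have [L0|L0] := leP 0 L; first by rewrite lebesgue_tuple_cube// ltry.
apply: (@le_lt_trans _ _ (lebesgue_tuple R N (cube a `|L|))); last first.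
  by rewrite lebesgue_tuple_cube// ltry.
apply: le_measure; rewrite ?inE; [exact: measurable_cube|exact: measurable_cube|].
move=> y H i; have := H i; have : 0 <= `|L| by [].
by move=> h1 /andP[h2 h3]; apply/andP; split; lra.
Qed.

Lemma lebesgue_tuple_sigma_finite N : sigma_finite setT (lebesgue_tuple R N).
Proof.
exists (fun n => cube (fun=> 0) n%:R).
  apply/esym/seteqP; split => // y _.
  pose M := \sum_(i < N) `|tnth y i|.
  exists (Num.truncn M).+1 => // i; rewrite sub0r add0r -ler_norml.
  apply: (@le_trans _ _ M); last by rewrite ltW// truncnS_gt.
  rewrite /M (bigD1 i)//= lerDl; exact: sumr_ge0.
by move=> n; split; [exact: measurable_cube|exact: lebesgue_tuple_cube_lty].
Qed.

(** A named set function on which sigma-finiteness is declared as a canonical instance; product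
    measures and Fubini's theorem ask for it. *)
Definition lebN N (A : set (N.-tuple T)) : \bar R := lebesgue_tuple R N A.

HB.instance Definition _ N := isMeasure.Build _ _ _ (@lebN N)
  (measure0 (lebesgue_tuple R N)) (measure_ge0 (lebesgue_tuple R N))
  (@measure_semi_sigma_additive _ _ _ (lebesgue_tuple R N)).

HB.instance Definition _ N := Measure_isSigmaFinite.Build _ _ _ (@lebN N)
  (lebesgue_tuple_sigma_finite N).

Lemma integral_lebesgue_tupleS N (f : N.+1.-tuple T -> R) :
  measurable_fun setT f ->
  (@lebN N \x lambda)%E.-integrable setT (EFin \o f \o @consp R N) ->
  (\int[lebesgue_tuple R N.+1]_y (f y)%:E =
   \int[@lebN N \x lambda]_z (f (consp z))%:E)%E.
Proof.
move=> mf intf; rewrite /= (@integral_pushforward _ _ _ _ _ _ (@measurable_consp R N))//.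
exact/measurable_EFinP.
Qed.

(** This class is stable under freezing a coordinate and implies integrability, which is what the
    induction in [integral_lines0] requires. *)
Definition bounded_on_cube N L M (f : N.-tuple T -> R) :=
  [/\ measurable_fun setT f, forall y, `|f y| <= M
    & forall y, ~ cube (fun=> 0) L y -> f y = 0].

Lemma bounded_on_cube_integrable N L M (f : N.-tuple T -> R) :
  bounded_on_cube L M f -> (@lebN N).-integrable setT (EFin \o f).
Proof.
move=> [mf fM f0]; apply: (@integrable_bounded_support _ _ _ _ (cube (fun=> 0) L) _ M) => //.
  exact: measurable_cube.
exact: lebesgue_tuple_cube_lty.
Qed.

Lemma cube_cons N L h (y : N.-tuple T) :
  cube (fun=> 0) L (consp (y, h)) <-> (- L <= h <= L) /\ cube (fun=> 0) L y.
Proof.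
rewrite /cube/=; split => [H|[H1 H2] i].
  split; first by have := H ord0; rewrite sub0r add0r.
  by move=> i; have := H (lift ord0 i); rewrite tnthS.
case: (unliftP ord0 i) => [j ->|->]; first by rewrite tnthS; exact: H2.
by rewrite sub0r add0r.
Qed.

(** This plays the part of the divergence theorem: an integral is shown to vanish by integrating in
    one direction only. The induction peels off head coordinates until direction [i] is the head. *)
Lemma integral_lines0 N (f : N.-tuple T -> R) L M (i : 'I_N) :
  bounded_on_cube L M f ->
  (forall y, \int[lambda]_s (f (updt y i s))%:E = 0)%E ->
  (\int[@lebN N]_y (f y)%:E = 0)%E.
Proof.
elim: N => [|N IH] in f i *; first by case: i.
move=> [mf fM f0] fi.
have mfc : measurable_fun setT (f \o @consp R N).
  by apply: measurableT_comp => //; exact: measurable_consp.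
have intf : (@lebN N \x lambda)%E.-integrable setT (EFin \o f \o @consp R N).
  apply: (@integrable_bounded_support _ _ _ (@lebN N \x lambda)%E
    (cube (fun=> 0) L `*` `[- L, L]) (f \o @consp R N) M) => //.
  - by apply: measurableX => //; exact: measurable_cube.
  - have := @product_measure1E _ _ _ _ _ (@lebN N) lambda (cube (fun=> 0) L) `[- L, L]
      (measurable_cube _ _) (measurable_itv _).
    move=> /= ->; rewrite lte_mul_pinfty//.
      by rewrite ge0_fin_numE//; exact: lebesgue_tuple_cube_lty.
    by rewrite lebesgue_measure_itv; case: ifP => //=; rewrite ltry.
  - by move=> y; exact: fM.
  - move=> [y h] /= n; apply: f0 => /cube_cons[h1 h2]; apply: n; split => //=.
rewrite [LHS](integral_lebesgue_tupleS mf intf).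
case: (unliftP ord0 i) => [j ij|i0].
  rewrite -(integral21_prod_meas1 intf).
  rewrite integral0_eq// => s _ /=.
  apply: (IH _ j).
    split => [|y|y yL]/=.
    - exact: (measurableT_comp mfc (measurable_pair2 _)).
    - exact: fM.
    - by apply: f0 => /cube_cons[].
  move=> y; rewrite -[RHS](fi (consp (y, s))) ij; apply: eq_integral => t _.
  congr (f _)%:E; apply: eq_from_tnth => k.
  rewrite tnth_mktuple; case: (unliftP ord0 k) => [k' ->|->].
    by rewrite !tnthS tnth_mktuple (inj_eq lift_inj).
  by rewrite -[_ == _]/false.
rewrite -(integral12_prod_meas1 intf).
rewrite integral0_eq// => y _ /=.
(* The head 0 is a placeholder, overwritten by [updt]. *)
rewrite -[RHS](fi (consp (y, 0))) i0; apply: eq_integral => t _.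
congr (f _)%:E; apply: eq_from_tnth => k.
rewrite tnth_mktuple; case: (unliftP ord0 k) => [k' ->|->].
  by rewrite !tnthS.
by rewrite eqxx.
Qed.

End lebesgue_tuple_theory.

(** * Touching paraboloids *)

Section real_valued_continuity.
Variables (R : realType) (X : topologicalType).
Implicit Types f g : X -> R.

Lemma contD f g : continuous f -> continuous g -> continuous (fun x => f x + g x).
Proof. by move=> cf cg x; apply: continuousD; [exact: cf|exact: cg]. Qed.

Lemma contB f g : continuous f -> continuous g -> continuous (fun x => f x - g x).
Proof. by move=> cf cg x; apply: continuousB; [exact: cf|exact: cg]. Qed.

Lemma contM f g : continuous f -> continuous g -> continuous (fun x => f x * g x).
Proof. by move=> cf cg x; apply: continuousM; [exact: cf|exact: cg]. Qed.

Lemma contX f n : continuous f -> continuous (fun x => f x ^+ n).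
Proof.
move=> cf x; apply: (@continuous_comp _ _ _ f (@GRing.exp R ^~ n)); first exact: cf.
exact: exprn_continuous.
Qed.

Lemma cont_cst (c : R) : continuous (fun _ : X => c).
Proof. by move=> x; exact: cvg_cst. Qed.

Lemma cont_max f g : continuous f -> continuous g ->
  continuous (fun x => Num.max (f x) (g x)).
Proof. by move=> cf cg x; apply: continuous_max; [exact: cf|exact: cg]. Qed.

Lemma cont_sum n (f : 'I_n -> X -> R) : (forall i, continuous (f i)) ->
  continuous (fun x => \sum_(i < n) f i x).
Proof. by move=> cf; apply: continuous_big => //; exact: add_continuous. Qed.

End real_valued_continuity.

(** * Truncated paraboloids as compactly supported weights *)

Section weights.
Variables (R : realType) (N : nat).
Implicit Types (a x : 'rV[R]_N) (z : R).

Definition sqd a x : R := dotv (x - a) (x - a).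
(** The parameter [z] is the squared radius of the support: the weight is then linear in [z] where
    it is positive, and the [z]-derivative of its square is twice the weight. *)
Definition wgt a z x : R := Num.max 0 (z - sqd a x).

Lemma sqdE a x : sqd a x = \sum_(i < N) (x ord0 i - a ord0 i) ^+ 2.
Proof. by apply: eq_bigr => i _; rewrite !mxE expr2. Qed.

Lemma sqd_ge0 a x : 0 <= sqd a x.
Proof. by rewrite sqdE sumr_ge0// => i _; exact: sqr_ge0. Qed.

Lemma sqd_coord a x i : (x ord0 i - a ord0 i) ^+ 2 <= sqd a x.
Proof. by rewrite sqdE (bigD1 i)//= lerDl sumr_ge0// => j _; exact: sqr_ge0. Qed.

Lemma continuous_sqd a : continuous (sqd a).
Proof.
rewrite (_ : sqd a = fun x => \sum_(i < N) (x ord0 i - a ord0 i) ^+ 2); last first.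
  by apply/funext => x; exact: sqdE.
apply: cont_sum => i; apply: contX; apply: contB; last exact: cont_cst.
exact: coord_continuous.
Qed.

Lemma continuous_wgt a z : continuous (wgt a z).
Proof. by apply: cont_max; [exact: cont_cst|apply: contB; [exact: cont_cst|exact: continuous_sqd]]. Qed.

Lemma wgt_ge0 a z x : 0 <= wgt a z x.
Proof. by rewrite le_max lexx. Qed.

Lemma wgt_neq0 a z x : wgt a z x != 0 -> sqd a x < z /\ wgt a z x = z - sqd a x.
Proof.
rewrite /wgt; have [h|h] := leP (z - sqd a x) 0; first by rewrite eqxx.
by move=> _; split => //; rewrite -subr_gt0.
Qed.

Lemma wgt_pos a z x : sqd a x < z -> wgt a z x = z - sqd a x.
Proof. by move=> h; rewrite /wgt max_r// subr_ge0 ltW. Qed.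

Lemma wgt0 a z x : z <= sqd a x -> wgt a z x = 0.
Proof. by move=> h; rewrite /wgt max_l// subr_le0. Qed.

(** Half-side of a cube centred at the origin that contains the support of [wgt a z]; [|z| + 1]
    bounds the square root of [z] without taking roots. *)
Definition supp_radius a z := \sum_(i < N) `|a ord0 i| + `|z| + 1.

Lemma sqd_supp a z x i : sqd a x < z -> `|x ord0 i| <= supp_radius a z.
Proof.
move=> xz; have := sqd_coord a x i.
have ai : `|a ord0 i| <= \sum_(i < N) `|a ord0 i|.
  by rewrite (bigD1 i)//= lerDl sumr_ge0.
rewrite /supp_radius; move: (\sum_(_ < _) _) ai => S ai h.
have z0 : z <= `|z| by exact: ler_norm.
have : `|x ord0 i - a ord0 i| <= `|z| + 1.
  rewrite -ler_sqr ?nnegrE ?addr_ge0// real_normK ?num_real//.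
  by nra.
have := ler_normD (x ord0 i - a ord0 i) (a ord0 i); rewrite subrK.
by lra.
Qed.

(** Integration is over the whole space; the weights do the localizing. *)
Definition rint (f : 'rV[R]_N -> R) : R := \int[@lebN R N]_y f (tvec y).

Lemma measurable_tvec (f : 'rV[R]_N -> R) : continuous f ->
  measurable_fun setT (fun y : N.-tuple (measurableTypeR R) => f (tvec y)).
Proof.
move=> cf; apply: (@measurable_continuous_rV _ _ _ _ (@tvec R N)) => // i.
rewrite (_ : (fun y => _) = (fun y => tnth y i)); first exact: measurable_tnth.
by apply/funext => y; rewrite mxE.
Qed.

Lemma continuous_bounded_cube (f : 'rV[R]_N -> R) L : continuous f ->
  exists M, forall x, (forall i, `|x ord0 i| <= L) -> `|f x| <= M.
Proof.
move=> cf; pose K : set 'rV[R]_N := [set x | forall i, (`[- L, L]%classic : set R) (x ord0 i)].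
have cK : compact K by apply: (@rV_compact _ _ (fun=> `[- L, L]%classic)) => i; exact: segment_compact.
have : compact (f @` K) by apply: continuous_compact => //; exact: continuous_subspaceT.
move=> /compact_bounded[M [Mr H]]; exists (M + 1) => x xL.
apply: (H (M + 1)); first by rewrite ltrDl.
exists x => // i /=; rewrite in_itv/= -ler_norml; exact: xL.
Qed.

(** The exponent is a successor because the power 0 of the weight is 1 everywhere and does not cut
    off. *)
Lemma bounded_on_cube_wgt a z (f : 'rV[R]_N -> R) k : continuous f ->
  exists M, bounded_on_cube (supp_radius a z) M
    (fun y : N.-tuple (measurableTypeR R) => f (tvec y) * wgt a z (tvec y) ^+ k.+1).
Proof.
move=> cf; have cfw : continuous (fun x => f x * wgt a z x ^+ k.+1).
  by apply: contM => //; apply: contX; exact: continuous_wgt.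
have w0 y : ~ cube (fun=> 0) (supp_radius a z) y -> wgt a z (tvec y) = 0.
  move=> yL; apply/eqP/negPn/negP => /wgt_neq0[h _]; apply: yL => i.
  by rewrite sub0r add0r -ler_norml; have := sqd_supp i h; rewrite mxE.
have [M HM] := continuous_bounded_cube (supp_radius a z) cfw.
exists (Num.max 0 M); split.
- exact: measurable_tvec cfw.
- move=> y; have [yL|/w0 ->] := pselect (cube (fun=> 0) (supp_radius a z) y).
    rewrite le_max; apply/orP; right; apply: HM => i.
    by have := yL i; rewrite sub0r add0r -ler_norml mxE.
  by rewrite exprS mul0r mulr0 normr0 le_max lexx.
- by move=> y /w0 ->; rewrite exprS mul0r mulr0.
Qed.

Lemma integrable_wgt a z (f : 'rV[R]_N -> R) k : continuous f ->
  (@lebN R N).-integrable setT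
    (EFin \o (fun y => f (tvec y) * wgt a z (tvec y) ^+ k.+1)).
Proof. by move=> /(bounded_on_cube_wgt a z k)[M]; exact: bounded_on_cube_integrable. Qed.

End weights.

Section pointwise_is_derive.
Variables (R : realType) (V : normedModType R).
Implicit Types (f g : V -> R) (x v : V).

Lemma is_derive_fun_eq x v f (df df' : R) :
  is_derive x v f df -> df = df' -> is_derive x v f df'.
Proof. by move=> ? <-. Qed.

Lemma is_derive_funB x v f g (df dg : R) : is_derive x v f df ->
  is_derive x v g dg -> is_derive x v (fun y => f y - g y) (df - dg).
Proof. by move=> hf hg; exact: is_deriveB. Qed.

Lemma is_derive_funM x v f g (df dg : R) : is_derive x v f df ->
  is_derive x v g dg -> is_derive x v (fun y => f y * g y) (f x * dg + g x * df).
Proof. by move=> hf hg; exact: is_deriveM. Qed.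

Lemma is_derive_funX x v f n (df : R) : is_derive x v f df ->
  is_derive x v (fun y => f y ^+ n.+1) (n.+1%:R * f x ^+ n * df).
Proof. by move=> hf; have := is_deriveX n.+1 hf; rewrite exprfctE. Qed.

Lemma is_derive_fun_cst x v (c : R) : is_derive x v (fun=> c) (0 : R).
Proof. exact: is_derive_cst. Qed.

End pointwise_is_derive.

(** The fundamental theorem of calculus on the chord |s - c| <= sqrt B, at whose endpoints the
    primitive [F] vanishes; [g] is [f] cut off outside the chord. For B <= 0 the last hypothesis
    already makes [g] zero. *)
Lemma integral_line0 (R : realType) (F f g : R -> R) (B c : R) :
  continuous f -> (forall s : R, is_derive s (1 : R) F (f s)) ->
  (forall s, (s - c) ^+ 2 = B -> F s = 0) ->
  (forall s, (s - c) ^+ 2 <= B -> g s = f s) ->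
  (forall s, B <= (s - c) ^+ 2 -> g s = 0) ->
  (\int[@lebesgue_measure R]_s (g s)%:E = 0)%E.
Proof.
move=> cf dF F0 gf g0.
have [B0|B0] := leP B 0.
  by rewrite integral0_eq// => s _; rewrite g0// (le_trans B0)// sqr_ge0.
pose b := Num.sqrt B; have b0 : 0 < b by rewrite sqrtr_gt0.
have bB : b ^+ 2 = B by rewrite sqr_sqrtr// ltW.
have FF s : derivable F s 1 by have [] := dF s.
have cF : continuous F.
  by move=> s; apply: differentiable_continuous; apply/derivable1_diffP.
rewrite (_ : (fun s => (g s)%:E) = (EFin \o f) \_ `[c - b, c + b]); last first.
  apply/funext => s; rewrite /patch; case: ifPn => [|].
    rewrite inE/= in_itv/= => /andP[h1 h2]; rewrite gf// -bB.
    have -> : (s - c) ^+ 2 = b ^+ 2 - (b - (s - c)) * (b + (s - c)) by ring.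
    by rewrite gerBl mulr_ge0//; lra.
  move=> /negP; rewrite inE/= in_itv/= => h; rewrite g0// -bB.
  have [h1|h1] := leP (s - c) 0.
    by have [h2|h2] := ltP (s - c) (- b); [nra|exfalso; apply: h; apply/andP; split; lra].
  by have [h2|h2] := ltP b (s - c); [nra|exfalso; apply: h; apply/andP; split; lra].
rewrite -integral_mkcond.
have := @continuous_FTC2 R f F (c - b) (c + b).
move=> /= ->.
- by rewrite !F0 ?sube0//; rewrite -bB; ring.
- lra.
- exact: continuous_subspaceT.
- by split => [x _||]; [exact: FF| |]; apply: cvg_within_filter; exact: cF.
- by move=> s _; rewrite derive1E; have [_ ->] := dF s.
Qed.

(** * Moment identities for the weights *)

Section moments.
Variables (R : realType) (N : nat) (a : 'rV[R]_N) (z : R).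
Local Notation T := (measurableTypeR R).
Local Notation w := (wgt a z).
Implicit Types f g : 'rV[R]_N -> R.

Lemma sqd_updt (y : N.-tuple T) i s : sqd a (tvec (updt y i s)) =
  (s - a ord0 i) ^+ 2 + \sum_(j < N | j != i) (tnth y j - a ord0 j) ^+ 2.
Proof.
rewrite sqdE (bigD1 i)//= mxE tnth_mktuple eqxx; congr (_ + _).
by apply: eq_bigr => j /negbTE ji; rewrite mxE tnth_mktuple ji.
Qed.

(** On a line in direction [i] the weight is the positive part of B - (s - c)^2, where c is the
    coordinate of [a] and B is [z] minus the squared distance in the other coordinates. There
    [p B (s - c)] is the restriction of [f] to the chord, and [F B c] is a primitive of the
    integrand that vanishes at both ends. In the hypothesis on [p], B is recovered as the weight
    plus (s - c)^2. *)
Lemma rint_lines0 (f : 'rV[R]_N -> R) k i (F : R -> R -> R -> R) (p : R -> R -> R) :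
  continuous f ->
  (forall B c, continuous (fun s => p B (s - c) * (B - (s - c) ^+ 2) ^+ k.+1)) ->
  (forall y s, sqd a (tvec (updt y i s)) <= z ->
     f (tvec (updt y i s)) = p (wgt a z (tvec (updt y i s)) + (s - a ord0 i) ^+ 2) (s - a ord0 i)) ->
  (forall B c s : R, is_derive s (1 : R) (F B c) (p B (s - c) * (B - (s - c) ^+ 2) ^+ k.+1)) ->
  (forall B c s, (s - c) ^+ 2 = B -> F B c s = 0) ->
  rint (fun x => f x * w x ^+ k.+1) = 0.
Proof.
move=> cf cp fp dF F0; rewrite /rint /Rintegral.
have [M HM] := bounded_on_cube_wgt a z k cf.
rewrite (integral_lines0 (i := i) HM)// => y.
pose B := z - \sum_(j < N | j != i) (tnth y j - a ord0 j) ^+ 2.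
have sB s : z - sqd a (tvec (updt y i s)) = B - (s - a ord0 i) ^+ 2.
  by rewrite sqd_updt /B opprD addrCA addrC.
apply: (@integral_line0 _ (F B (a ord0 i))
  (fun s => p B (s - a ord0 i) * (B - (s - a ord0 i) ^+ 2) ^+ k.+1) _ B (a ord0 i)).
- exact: cp.
- by move=> s; exact: F0.
- move=> s; rewrite -subr_ge0 -sB subr_ge0 => h.
  have E : w (tvec (updt y i s)) = B - (s - a ord0 i) ^+ 2.
    by rewrite /wgt max_r sB// -sB subr_ge0.
  by rewrite fp// E subrK sB.
- by move=> s; rewrite -subr_le0 -sB subr_le0 => /wgt0 w0; rewrite w0; rewrite exprS mul0r mulr0.
Qed.

(** The integrand is odd about [a]; rather than by reflection, it is integrated as the derivative of
    - w^(k+2) / (2 (k+2)) along the line. *)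
Lemma rint_coord_wgt k i : rint (fun x => (x ord0 i - a ord0 i) * w x ^+ k.+1) = 0.
Proof.
apply: (@rint_lines0 (fun x => x ord0 i - a ord0 i) k i
  (fun B c s => - (2 * k.+2%:R)^-1 * (B - (s - c) ^+ 2) ^+ k.+2) (fun _ t => t)).
- by apply: contB; [exact: coord_continuous|exact: cont_cst].
- move=> B c; have cc : continuous (fun s : R => s - c).
    by apply: contB; [by move=> x; exact: cvg_id|exact: cont_cst].
  by apply: contM => //; apply: contX; apply: contB; [exact: cont_cst|exact: contX].
- by move=> y s _; rewrite mxE tnth_mktuple eqxx.
- move=> B c s.
  have h1 : is_derive s (1 : R) (fun s : R => s - c) (1 - 0).
    by apply: is_derive_funB; exact: is_derive_fun_cst.
  have h2 := is_derive_funX k.+1 (is_derive_funB (is_derive_fun_cst s (1 : R) B)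
    (is_derive_funX 1 h1)).
  apply: is_derive_fun_eq (is_derive_funM (is_derive_fun_cst s (1 : R) _) h2) _.
  rewrite mulr0 addr0 expr1.
  have k0 : (k.+2%:R : R) != 0 by rewrite pnatr_eq0.
  move: (k.+2%:R) k0 (_ ^+ k.+1) => K K0 E.
  by field.
- by move=> B c s ->; rewrite subrr expr0n/= mulr0.
Qed.

(** Inside the support the integrand is the derivative of (x_i - a_i) w^(k+2) in the direction
    x_i. *)
Lemma rint_wgt_succ k i :
  rint (fun x => (w x - 2 * k.+2%:R * (x ord0 i - a ord0 i) ^+ 2) * w x ^+ k.+1) = 0.
Proof.
apply: (@rint_lines0 (fun x => w x - 2 * k.+2%:R * (x ord0 i - a ord0 i) ^+ 2) k i
  (fun B c s => (s - c) * (B - (s - c) ^+ 2) ^+ k.+2)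
  (fun B t => B - t ^+ 2 - 2 * k.+2%:R * t ^+ 2)).
- apply: contB; first exact: continuous_wgt.
  apply: contM; first exact: cont_cst.
  by apply: contX; apply: contB; [exact: coord_continuous|exact: cont_cst].
- move=> B c; have cc : continuous (fun s : R => s - c).
    by apply: contB; [by move=> x; exact: cvg_id|exact: cont_cst].
  apply: contM; last by apply: contX; apply: contB; [exact: cont_cst|exact: contX].
  apply: contB; first by apply: contB; [exact: cont_cst|exact: contX].
  by apply: contM; [exact: cont_cst|exact: contX].
- by move=> y s _; rewrite addrK mxE tnth_mktuple eqxx.
- move=> B c s.
  have h1 : is_derive s (1 : R) (fun s : R => s - c) (1 - 0).
    by apply: is_derive_funB; exact: is_derive_fun_cst.
  have h2 := is_derive_funX k.+1 (is_derive_funB (is_derive_fun_cst s (1 : R) B)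
    (is_derive_funX 1 h1)).
  apply: is_derive_fun_eq (is_derive_funM h1 h2) _.
  by rewrite expr1 [(_ - _) ^+ k.+2]exprS; ring.
- by move=> B c s ->; rewrite subrr expr0n/= mulr0.
Qed.

Lemma rint_wgtD f g k l : continuous f -> continuous g ->
  rint (fun x => f x * w x ^+ k.+1 + g x * w x ^+ l.+1) =
  rint (fun x => f x * w x ^+ k.+1) + rint (fun x => g x * w x ^+ l.+1).
Proof. by move=> cf cg; rewrite /rint RintegralD//; exact: integrable_wgt. Qed.

Lemma rint_wgtZ c f k : continuous f ->
  rint (fun x => c * (f x * w x ^+ k.+1)) = c * rint (fun x => f x * w x ^+ k.+1).
Proof. by move=> cf; rewrite /rint RintegralZl//; exact: integrable_wgt. Qed.

Lemma rint_wgt_sum n (f : 'I_n -> 'rV[R]_N -> R) k : (forall i, continuous (f i)) ->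
  rint (fun x => (\sum_(i < n) f i x) * w x ^+ k.+1) =
  \sum_(i < n) rint (fun x => f i x * w x ^+ k.+1).
Proof.
elim: n f => [|n IH] f cf.
  rewrite big_ord0 /rint /Rintegral integral0_eq// => x _.
  by rewrite big_ord0 mul0r.
rewrite big_ord_recl -IH// -rint_wgtD//; last by apply: cont_sum => i; exact: cf.
by apply: eq_Rintegral => x _; rewrite big_ord_recl mulrDl.
Qed.

Lemma eq_rint (f g : 'rV[R]_N -> R) : f =1 g -> rint f = rint g.
Proof. by move=> fg; apply: eq_Rintegral => x _; exact: fg. Qed.

Lemma rint_cst_wgt c k :
  rint (fun x => c * w x ^+ k.+1) = c * rint (fun x => w x ^+ k.+1).
Proof.
have c1 : continuous (fun _ : 'rV[R]_N => 1 : R) by exact: cont_cst.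
rewrite (@eq_rint _ (fun x => c * (1 * w x ^+ k.+1))) ?rint_wgtZ//.
  by congr (_ * _); apply: eq_rint => x; rewrite mul1r.
by move=> x; rewrite mul1r.
Qed.

(** Sum [rint_wgt_succ] over all directions and replace |x - a|^2 by z - w on the support. Only such
    ratios and the positivity of the moments of the weight are used; the moments are never
    evaluated. *)
Lemma rint_wgt_rec k : (N%:R + 2 * k.+2%:R) * rint (fun x => w x ^+ k.+2) =
  2 * k.+2%:R * z * rint (fun x => w x ^+ k.+1).
Proof.
have : rint (fun x => (\sum_(i < N) (w x - 2 * k.+2%:R * (x ord0 i - a ord0 i) ^+ 2)) * w x ^+ k.+1) = 0.
  rewrite rint_wgt_sum ?big1// => [i _|i]; first exact: rint_wgt_succ.
  apply: contB; first exact: continuous_wgt.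
  apply: contM; first exact: cont_cst.
  by apply: contX; apply: contB; [exact: coord_continuous|exact: cont_cst].
have E x : (\sum_(i < N) (w x - 2 * k.+2%:R * (x ord0 i - a ord0 i) ^+ 2)) * w x ^+ k.+1 =
  (N%:R + 2 * k.+2%:R) * w x ^+ k.+2 + (- (2 * k.+2%:R * z)) * w x ^+ k.+1.
  rewrite big_split/= sumr_const card_ord sumrN -mulr_sumr -sqdE.
  have [->|/wgt_neq0[_ h]] := eqVneq (w x) 0; first by rewrite !exprS !mul0r !mulr0 addr0.
  rewrite (_ : sqd a x = z - w x); last by rewrite h; ring.
  by rewrite [w x ^+ k.+2]exprS -mulr_natl; ring.
rewrite (eq_rint E) rint_wgtD; [|exact: cont_cst|exact: cont_cst].
by rewrite !rint_cst_wgt => /eqP; rewrite mulNr subr_eq0 => /eqP.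
Qed.

End moments.

Lemma is_derive_quadratic (R : realType) (F : R -> R) (z d C e : R) : 0 < e ->
  (forall h, `|h| < e -> `|F (z + h) - F z - h * d| <= C * h ^+ 2) ->
  is_derive z (1 : R) F d.
Proof.
move=> e0 H.
suff cF : (fun h => h^-1 *: ((F \o shift z) (h *: (1 : R)) - F z)) @ 0^' --> d.
  by apply: DeriveDef; [exact: cvgP cF|exact: cvg_lim cF].
apply/cvgrPdist_le => eps eps0; near=> h.
have h0 : h != 0 by near: h; exact: nbhs_dnbhs_neq.
have he : `|h| < e by near: h; apply: dnbhs0_lt.
have hC : `|h| < eps / (`|C| + 1).
  by near: h; apply: dnbhs0_lt; rewrite divr_gt0// ltr_wpDl.
rewrite /= /shift/= [h *: 1]mulr1 [h + z]addrC.
have -> : d - h^-1 *: (F (z + h) - F z) = - (h^-1 * (F (z + h) - F z - h * d)).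
  rewrite /GRing.scale/=; move: (F (z + h)) (F z) => A B.
  by rewrite [X in _ = - X]mulrBr mulKf//; ring.
rewrite normrN normrM normfV ler_pdivrMl ?normr_gt0//.
apply: (le_trans (H h he)).
rewrite -(@real_normK _ h) ?num_real// expr2 mulrA [leRHS]mulrC ler_pM2r ?normr_gt0//.
move: hC; rewrite ltr_pdivlMr ?ltr_wpDl// => hC.
have := ler_norm C; have := normr_ge0 h; have := normr_ge0 C.
by nra.
Unshelve. all: by end_near. Qed.

Section touching.
Variables (R : realType) (N : nat).
Local Notation T := (measurableTypeR R).
Implicit Types (a x : 'rV[R]_N) (f g : 'rV[R]_N -> R).

Lemma nbhs_sqd a (A : set 'rV[R]_N) : nbhs a A ->
  exists2 z, 0 < z & forall x, sqd a x < z -> A x.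
Proof.
move=> /nbhs_ballP[e /= e0 eA]; exists (e ^+ 2); first exact: exprn_gt0.
move=> x h; apply: eA; split => // i j; rewrite (ord1 i).
have := le_lt_trans (sqd_coord a x j) h.
rewrite /ball/= distrC -(@real_normK _ (_ - _)) ?num_real//.
by rewrite ltr_pXn2r ?nnegrE// ltW.
Qed.

Lemma integrable_cube a L : (@lebN R N).-integrable setT
  (EFin \o (fun y => \1_(cube (a ord0) L) y)).
Proof.
apply: (@integrable_bounded_support _ _ _ _ (cube (a ord0) L) _ 1).
- exact: measurable_cube.
- exact: lebesgue_tuple_cube_lty.
- by apply: measurable_indic; exact: measurable_cube.
- by move=> y; rewrite indicE; case: (_ \in _); rewrite ?normr1 ?normr0.
- by move=> y h; rewrite indicE memNset.
Qed.

Lemma Rintegral_cube a L : 0 <= L ->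
  \int[@lebN R N]_y (\1_(cube (a ord0) L) y) = (L *+ 2) ^+ N.
Proof.
move=> L0; rewrite /Rintegral integral_indic//; last exact: measurable_cube.
by rewrite setIT; have /= := lebesgue_tuple_cube (a ord0) L0; rewrite /lebN => ->.
Qed.

Lemma rint_ge_cube (F : 'rV[R]_N -> R) a L c : 0 <= L ->
  (@lebN R N).-integrable setT (EFin \o (F \o @tvec R N)) ->
  (forall x, (forall i, a ord0 i - L <= x ord0 i <= a ord0 i + L) -> c <= F x) ->
  (forall x, 0 <= F x) -> c * (L *+ 2) ^+ N <= rint F.
Proof.
move=> L0 iF H F0; rewrite -(Rintegral_cube a L0) -RintegralZl//; last exact: integrable_cube.
apply: le_Rintegral => //.
  have := integrableZl measurableT c (integrable_cube a L).
  by apply: eq_integrable => // y _ /=; rewrite EFinM.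
move=> y _; rewrite indicE; case: (boolP (y \in _)) => [|_]; last by rewrite mulr0.
rewrite inE mulr1 => h; apply: H => i; have := h i; by rewrite mxE.
Qed.

Lemma rint_le_cube (F : 'rV[R]_N -> R) a L c : 0 <= L ->
  (@lebN R N).-integrable setT (EFin \o (F \o @tvec R N)) ->
  (forall x, (forall i, a ord0 i - L <= x ord0 i <= a ord0 i + L) -> F x <= c) ->
  (forall x i, ~~ (a ord0 i - L <= x ord0 i <= a ord0 i + L) -> F x <= 0) ->
  rint F <= c * (L *+ 2) ^+ N.
Proof.
move=> L0 iF H F0; rewrite -(Rintegral_cube a L0) -RintegralZl//; last exact: integrable_cube.
apply: le_Rintegral => //.
  have := integrableZl measurableT c (integrable_cube a L).
  by apply: eq_integrable => // y _ /=; rewrite EFinM.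
move=> y _; rewrite indicE; case: (boolP (y \in _)) => [|].
  by rewrite inE mulr1 => h; apply: H => i; have := h i; rewrite mxE.
rewrite notin_setE mulr0 => /existsNP[i /negP h]; apply: (F0 _ i).
by rewrite mxE.
Qed.

Lemma rint_wgt_gt0 a z k : 0 < z -> 0 < rint (fun x => wgt a z x ^+ k.+1).
Proof.
(* As L <= 1 and L <= z / (2 (N + 1)), on the cube |x - a|^2 <= N L^2 <= N L <= z / 2, so the weight
   is at least z / 2 there. N + 1 keeps the denominator nonzero. *)
move=> z0; pose L := Num.min 1 (z / (N.+1%:R * 2)).
have N0 : 0 < N.+1%:R * 2 :> R by rewrite mulr_gt0.
have L0 : 0 < L by rewrite lt_min ltr01 divr_gt0.
have : (z / 2) ^+ k.+1 * (L *+ 2) ^+ N <= rint (fun x => wgt a z x ^+ k.+1).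
  apply: (@rint_ge_cube _ a L); first exact: ltW.
  - have := @integrable_wgt R N a z (fun=> 1) k (@cont_cst _ _ _).
    by apply: eq_integrable => // y _ /=; rewrite mul1r.
  - move=> x h.
    have xz : sqd a x <= z / 2.
      apply: (@le_trans _ _ (\sum_(i < N) L)).
        rewrite sqdE; apply: ler_sum => i _; have /andP[h1 h2] := h i.
        have L1 : L <= 1 by rewrite ge_min lexx.
        by nra.
      rewrite sumr_const card_ord -mulr_natl.
      have : L <= z / (N.+1%:R * 2) by rewrite ge_min lexx orbT.
      rewrite ler_pdivlMr// -natr1 => h1.
      have : 0 <= N%:R :> R by [].
      by nra.
    have z2 : z / 2 < z by lra.
    rewrite wgt_pos ?(le_lt_trans xz)//.
    by rewrite lerXn2r ?nnegrE; lra.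
  - by move=> x; rewrite exprn_ge0// wgt_ge0.
apply: lt_le_trans; rewrite mulr_gt0// exprn_gt0 ?mulrn_wgt0//.
by rewrite divr_gt0.
Qed.

End touching.

Section touching_lemma.
Variables (R : realType) (N : nat).
Implicit Types (a x : 'rV[R]_N) (f g : 'rV[R]_N -> R).

(* The Laplacian of (z - |x - a|^2)_+^3. *)
Definition lapw a z x : R :=
  24 * z * wgt a z x - (6 * N%:R + 24) * wgt a z x ^+ 2.

Lemma integrable_lapw a z f : continuous f ->
  (@lebN R N).-integrable setT (EFin \o (fun y => f (tvec y) * lapw a z (tvec y))).
Proof.
move=> cf.
have c1 : continuous (fun x => 24 * z * f x) by apply: contM => //; exact: cont_cst.
have c2 : continuous (fun x => - (6 * N%:R + 24) * f x) by apply: contM => //; exact: cont_cst.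
have := integrableD measurableT (integrable_wgt a z 0 c1) (integrable_wgt a z 1 c2).
by apply: eq_integrable => // y _ /=; rewrite -EFinD /lapw expr1; congr (_%:E); ring.
Qed.

Lemma rint_lapw a z f : continuous f ->
  rint (fun x => f x * lapw a z x) =
  24 * z * rint (fun x => f x * wgt a z x ^+ 1) -
  (6 * N%:R + 24) * rint (fun x => f x * wgt a z x ^+ 2).
Proof.
move=> cf; rewrite -mulNr -!rint_wgtZ//.
have c1 : continuous (fun x => 24 * z * f x) by apply: contM => //; exact: cont_cst.
have c2 : continuous (fun x => - (6 * N%:R + 24) * f x) by apply: contM => //; exact: cont_cst.
rewrite (@eq_rint _ _ (fun x => 24 * z * (f x * wgt a z x ^+ 1))
  (fun x => (24 * z * f x) * wgt a z x ^+ 1)); last by move=> x; rewrite mulrA.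
rewrite (@eq_rint _ _ (fun x => - (6 * N%:R + 24) * (f x * wgt a z x ^+ 2))
  (fun x => (- (6 * N%:R + 24) * f x) * wgt a z x ^+ 2)); last by move=> x; rewrite mulrA.
by rewrite -rint_wgtD//; apply: eq_rint => x; rewrite /lapw expr1; ring.
Qed.

(** The paraboloid al |x|^2 + const expanded about [a], with [b] its value at [a]; the linear part
    is odd about [a] and drops out of every moment. *)
Definition quad a (al b : R) x : R :=
  b + \sum_(i < N) (2 * al * a ord0 i) * (x ord0 i - a ord0 i) + al * sqd a x.

Lemma continuous_quad a al b : continuous (quad a al b).
Proof.
apply: contD; last by apply: contM; [exact: cont_cst|exact: continuous_sqd].
apply: contD; first exact: cont_cst.
apply: cont_sum => i; apply: contM; first exact: cont_cst.
by apply: contB; [exact: coord_continuous|exact: cont_cst].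
Qed.

Lemma quadE a al b x : al * dotv x x + b = quad a al (al * dotv a a + b) x.
Proof.
rewrite /quad sqdE /dotv.
have -> : al * (\sum_(i < N) x ord0 i * x ord0 i) = al * (\sum_(i < N) a ord0 i * a ord0 i)
    + \sum_(i < N) 2 * al * a ord0 i * (x ord0 i - a ord0 i)
    + al * \sum_(i < N) (x ord0 i - a ord0 i) ^+ 2.
  by rewrite !mulr_sumr -!big_split; apply: eq_bigr => i _ /=; ring.
by ring.
Qed.

Lemma rint_quad_wgt a z al b k : rint (fun x => quad a al b x * wgt a z x ^+ k.+1) =
  (b + al * z) * rint (fun x => wgt a z x ^+ k.+1) - al * rint (fun x => wgt a z x ^+ k.+2).
Proof.
have cl : continuous (fun x => \sum_(i < N) (2 * al * a ord0 i) * (x ord0 i - a ord0 i)).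
  apply: cont_sum => i; apply: contM; first exact: cont_cst.
  by apply: contB; [exact: coord_continuous|exact: cont_cst].
have E0 : rint (fun x => (\sum_(i < N) (2 * al * a ord0 i) * (x ord0 i - a ord0 i)) * wgt a z x ^+ k.+1) = 0.
  rewrite rint_wgt_sum ?big1// => [i _|i].
    rewrite (@eq_rint _ _ _ (fun x => (2 * al * a ord0 i) * ((x ord0 i - a ord0 i) * wgt a z x ^+ k.+1))).
      rewrite rint_wgtZ ?rint_coord_wgt ?mulr0//.
      by apply: contB; [exact: coord_continuous|exact: cont_cst].
    by move=> x; rewrite mulrA.
  apply: contM; first exact: cont_cst.
  by apply: contB; [exact: coord_continuous|exact: cont_cst].
pose F x := (\sum_(i < N) (2 * al * a ord0 i) * (x ord0 i - a ord0 i)) + (b + al * z).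
have cF : continuous F by apply: contD => //; exact: cont_cst.
rewrite (@eq_rint _ _ _ (fun x => F x * wgt a z x ^+ k.+1 + (- al) * wgt a z x ^+ k.+2)).
  rewrite rint_wgtD//; last exact: cont_cst.
  rewrite rint_cst_wgt mulNr; congr (_ - _).
  rewrite (@eq_rint _ _ _ (fun x =>
    (\sum_(i < N) (2 * al * a ord0 i) * (x ord0 i - a ord0 i)) * wgt a z x ^+ k.+1
    + (b + al * z) * wgt a z x ^+ k.+1)); last by move=> x; rewrite mulrDl.
  rewrite rint_wgtD ?E0 ?add0r ?rint_cst_wgt//; exact: cont_cst.
move=> x; rewrite /F /quad.
have [->|/wgt_neq0[_ h]] := eqVneq (wgt a z x) 0; first by rewrite !exprS !mul0r !mulr0 addr0.
rewrite (_ : sqd a x = z - wgt a z x); last by rewrite h; ring.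
by rewrite [_ ^+ k.+2]exprS; ring.
Qed.

(** Green's identity: the Laplacian is moved from w^3 to the paraboloid, whose Laplacian is 2 N al.
    It follows from two instances of the moment recursion, without any boundary integral. *)
Lemma rint_quad_lapw a z al b : rint (fun x => quad a al b x * lapw a z x) =
  2 * N%:R * al * rint (fun x => wgt a z x ^+ 3).
Proof.
rewrite rint_lapw; last exact: continuous_quad.
rewrite !rint_quad_wgt.
set B1 := rint (fun x => wgt a z x ^+ 1); set B2 := rint (fun x => wgt a z x ^+ 2).
set B3 := rint (fun x => wgt a z x ^+ 3).
have h1 : (N%:R + 2 * 2) * B2 = 2 * 2 * z * B1 := rint_wgt_rec a z 0.
have h2 : (N%:R + 2 * 3) * B3 = 2 * 3 * z * B2 := rint_wgt_rec a z 1.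
have e1 : (6 * N%:R + 24) * B2 = 24 * z * B1 by lra.
have e2 : 24 * z * B2 = 4 * (N%:R + 6) * B3 by lra.
transitivity (b * (24 * z * B1 - (6 * N%:R + 24) * B2) + al * z * (24 * z * B1 - (6 * N%:R + 24) * B2)
   - al * (24 * z * B2) + al * (6 * N%:R + 24) * B3); first by ring.
by rewrite e1 e2; ring.
Qed.

End touching_lemma.

(** * Growth of the second moment as the ball expands *)

Section decay.
Variables (R : realType) (N : nat) (a : 'rV[R]_N) (f : 'rV[R]_N -> R).
Hypothesis cf : continuous f.
Local Notation mom k z := (rint (fun x => f x * wgt a z x ^+ k)).

(** The squared positive part is C^1 with Lipschitz derivative, though not C^2; a quadratic
    remainder is all that differentiation in [z] requires. *)
Lemma sqr_pospart_taylor (p h : R) :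
  `|Num.max 0 (p + h) ^+ 2 - Num.max 0 p ^+ 2 - 2 * h * Num.max 0 p| <= h ^+ 2.
Proof.
rewrite ler_norml.
have [p1|p1] := leP p 0; have [h1|h1] := leP (p + h) 0; apply/andP; split; nra.
Qed.

(** For |h| < 1 the first-order remainder is at most h^2 and vanishes unless |x - a|^2 < z + 1,
    where [wgt a (z + 2)] exceeds 1. This weight therefore serves as a continuous substitute for an
    indicator function. *)
Lemma is_derive_mom2 z : is_derive z (1 : R) (fun z => mom 2 z) (2 * mom 1 z).
Proof.
have cnf : continuous (fun x => `|f x|).
  by move=> x; apply: continuous_comp; [exact: cf|exact: norm_continuous].
apply: (@is_derive_quadratic _ _ _ _ (rint (fun x => `|f x| * wgt a (z + 2) x ^+ 1)) 1) => // h h1.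
pose D x := wgt a (z + h) x ^+ 2 - wgt a z x ^+ 2 - 2 * h * wgt a z x.
have i1 := integrable_wgt a (z + h) 1 cf.
have i2 := integrable_wgt a z 1 cf.
have c3 : continuous (fun x => 2 * h * f x) by apply: contM => //; exact: cont_cst.
have i3 := integrable_wgt a z 0 c3.
have i12 := integrableB measurableT i1 i2.
have i123 := integrableB measurableT i12 i3.
have iD : (@lebN R N).-integrable setT (EFin \o (fun y => f (tvec y) * D (tvec y))).
  move: i123; apply: eq_integrable => // y _ /=.
  by rewrite -!EFinB /D expr1; congr (_%:E); ring.
have -> : mom 2 (z + h) - mom 2 z - h * (2 * mom 1 z) = rint (fun x => f x * D x).
  rewrite (_ : h * (2 * mom 1 z) = rint (fun x => 2 * h * f x * wgt a z x ^+ 1)); last first.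
    rewrite mulrA [h * 2]mulrC -rint_wgtZ//; apply: eq_rint => x; exact: mulrA.
  rewrite /rint -RintegralB// -RintegralB//.
  by apply: eq_Rintegral => y _; rewrite /D expr1; ring.
apply: (le_trans (le_normr_Rintegral measurableT iD)).
have c4 : continuous (fun x => h ^+ 2 * `|f x|) by apply: contM => //; exact: cont_cst.
have i4 := integrable_wgt a (z + 2) 0 c4.
rewrite mulrC -rint_wgtZ//; apply: le_Rintegral => //.
- exact: integrable_norm iD.
- by move: i4; apply: eq_integrable => // y _ /=; rewrite mulrA.
move=> y _; rewrite normrM expr1 mulrCA ler_wpM2l//.
have DE : D (tvec y) = Num.max 0 (z - sqd a (tvec y) + h) ^+ 2 - Num.max 0 (z - sqd a (tvec y)) ^+ 2
   - 2 * h * Num.max 0 (z - sqd a (tvec y)) by rewrite /D /wgt [z + h - _]addrAC.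
have [h2|h2] := leP (z + 1) (sqd a (tvec y)).
  have hh := ltr_normlW h1.
  have w1 : wgt a (z + h) (tvec y) = 0 by apply: wgt0; lra.
  have w2 : wgt a z (tvec y) = 0 by apply: wgt0; lra.
  by rewrite /D w1 w2 expr0n/= mulr0 !subr0 normr0 mulr_ge0 ?sqr_ge0// wgt_ge0.
rewrite DE (le_trans (sqr_pospart_taylor _ _))// ler_peMr ?sqr_ge0//.
by rewrite wgt_pos; lra.
Qed.

Lemma mom_ge0 k z : (forall x, sqd a x < z -> 0 <= f x) -> 0 <= mom k.+1 z.
Proof.
move=> f0; apply: Rintegral_ge0 => y _.
have [->|/wgt_neq0[h _]] := eqVneq (wgt a z (tvec y)) 0; first by rewrite exprS mul0r mulr0.
by rewrite mulr_ge0 ?f0// exprn_ge0// wgt_ge0.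
Qed.

Lemma mom2_le z e : 0 < z -> 0 <= e -> (forall x, sqd a x < z -> f x <= e) ->
  mom 2 z <= e * z ^+ 2 * (Num.sqrt z *+ 2) ^+ N.
Proof.
move=> z0 e0 fe; apply: (@rint_le_cube _ _ _ a).
- exact: sqrtr_ge0.
- exact: integrable_wgt.
- move=> x _; have [->|/wgt_neq0[h ->]] := eqVneq (wgt a z x) 0.
    by rewrite exprS mul0r mulr0 mulr_ge0// sqr_ge0.
  have s0 := sqd_ge0 a x.
  apply: (@le_trans _ _ (e * (z - sqd a x) ^+ 2)).
    by rewrite ler_wpM2r ?sqr_ge0// fe.
  by rewrite ler_wpM2l// lerXn2r ?nnegrE; lra.
- move=> x i /negP h; rewrite wgt0; first by rewrite exprS mul0r mulr0.
  rewrite leNgt; apply/negP => h2; apply: h.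
  have : (x ord0 i - a ord0 i) ^+ 2 < Num.sqrt z ^+ 2.
    by rewrite sqr_sqrtr ?ltW//; exact: le_lt_trans (sqd_coord _ _ _) h2.
  have : 0 <= Num.sqrt z by exact: sqrtr_ge0.
  move: (Num.sqrt z) => s s0 hs.
  by apply/andP; split; nra.
Qed.

(* Squared, so that the exponent N/2 + 2 becomes an integer. *)
Definition growth_ratio (z : R) : R := mom 2 z ^+ 2 * (z^-1) ^+ N.+4.

Lemma growth_ratio_derive (z : R) : 0 < z -> is_derive z (1 : R) growth_ratio
  ((z^-1) ^+ N.+4 * z^-1 * mom 2 z * (4 * z * mom 1 z - N.+4%:R * mom 2 z)).
Proof.
move=> z0.
have zn0 : z != 0 by rewrite gt_eqF.
have d1 := is_derive_funX 1 (is_derive_mom2 z).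
have d2 : is_derive z (1 : R) (fun z : R => z^-1) (- z ^- 2).
  apply: DeriveDef; first by apply: derivableV => //; exact: derivable_id.
  by rewrite deriveV// derive_id [LHS]mulr1.
have d3 := is_derive_funX N.+3 d2.
apply: is_derive_fun_eq (is_derive_funM d1 d3) _.
rewrite expr1 [_ ^+ N.+4]exprS; move: (mom 2 z) (mom 1 z) (N.+4%:R) (_ ^+ N.+3) => A B n E.
by field.
Qed.

Lemma growth_ratio_le z2 : (forall z, 0 < z < z2 -> 0 <= mom 2 z) ->
  (forall z, 0 < z < z2 -> 4 * z * mom 1 z <= N.+4%:R * mom 2 z) ->
  forall x y, 0 < x -> x <= y -> y < z2 -> growth_ratio y <= growth_ratio x.
Proof.
move=> m0 m4 x y x0 xy yz.
have dG (z : R) : z \in `]0, z2[%R -> is_derive z (1 : R) growth_ratio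
  ((z^-1) ^+ N.+4 * z^-1 * mom 2 z * (4 * z * mom 1 z - N.+4%:R * mom 2 z)).
  by rewrite in_itv/= => /andP[z0 _]; exact: growth_ratio_derive.
apply: (@ler0_derive1_le_oo R growth_ratio 0 z2).
- by move=> z /dG [].
- move=> z zz; rewrite derive1E; have [_ ->] := dG z zz.
  move: zz; rewrite in_itv/= => zz; have /andP[z0 _] := zz.
  rewrite mulr_ge0_le0 ?subr_le0 ?m4// mulr_ge0 ?m0// mulr_ge0 ?exprn_ge0 ?invr_ge0 ?ltW//.
- move=> z /set_mem/= /dG[dz _]; apply: differentiable_continuous.
  by apply/derivable1_diffP.
- by rewrite in_itv/= yz andbT; exact: lt_le_trans x0 xy.
- by rewrite in_itv/= x0; exact: le_lt_trans xy yz.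
- exact: xy.
Qed.

(** The inequality to be refuted makes [growth_ratio] nonincreasing. Since f is continuous with f a
    = 0, [mom 2 z] is o(z^(2 + N/2)), so the ratio tends to 0 as z does and cannot be positive
    anywhere. Then [mom 2] vanishes, and the strict inequality contradicts [mom 1] >= 0. *)
Lemma mom_growth z2 : 0 < z2 -> f a = 0 -> (forall x, sqd a x < z2 -> 0 <= f x) ->
  ~ (forall z, 0 < z < z2 -> 4 * z * mom 1 z < N.+4%:R * mom 2 z).
Proof.
move=> z20 fa f0 H.
have m0 k z : 0 < z < z2 -> 0 <= mom k.+1 z.
  by move=> /andP[_ zz]; apply: mom_ge0 => x xz; apply: f0; exact: lt_trans zz.
have mono := growth_ratio_le (m0 1%N) (fun z hz => ltW (H z hz)).
pose y := z2 / 2; have y0 : 0 < y by rewrite divr_gt0.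
have yz : y < z2 by rewrite /y; lra.
have yy : 0 < y < z2 by rewrite y0.
have [G0|G0] := leP (growth_ratio y) 0.
  have my : mom 2 y = 0.
    have : mom 2 y ^+ 2 <= 0.
      by rewrite -(@pmulr_lle0 _ ((y^-1) ^+ N.+4)) ?exprn_gt0 ?invr_gt0.
    by move=> h; apply/eqP; rewrite -sqrf_eq0 eq_le h sqr_ge0.
  have := H y yy; rewrite my mulr0 ltNge mulr_ge0 ?m0//.
  by rewrite mulr_ge0// ltW.
(* At small z the ratio is at most e^2 4^N, and e <= 1 gives e^2 4^N <= e 4^N <= [growth_ratio y] /
   2. *)
pose e := Num.min 1 (growth_ratio y / (4 ^+ N * 2)).
have p4 : 0 < 4 ^+ N :> R by rewrite exprn_gt0.
have e0 : 0 < e by rewrite lt_min ltr01 divr_gt0// mulr_gt0.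
have : \forall x \near a, f x < e.
  by have : f @ a --> f a := @cf a; rewrite fa => /cvgr_lt; exact.
move=> /nbhs_sqd[z1 z10 fz1].
pose z := Num.min y (z1 / 2).
have z0 : 0 < z by rewrite lt_min y0 divr_gt0.
have zy : z <= y by rewrite ge_min lexx.
have zz1 : z < z1.
  by apply: (@le_lt_trans _ _ (z1 / 2)); [rewrite ge_min lexx orbT|lra].
have := mono z y z0 zy yz; apply/negP; rewrite -ltNge.
have zz2 : 0 < z < z2 by rewrite z0 (le_lt_trans zy).
have M2 := @mom2_le z e z0 (ltW e0) (fun x hx => ltW (fz1 x (lt_trans hx zz1))).
have G1 : growth_ratio z <= e ^+ 2 * 4 ^+ N.
  rewrite /growth_ratio exprVn ler_pdivrMr ?exprn_gt0//.
  apply: (@le_trans _ _ ((e * z ^+ 2 * (Num.sqrt z *+ 2) ^+ N) ^+ 2)).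
    by rewrite lerXn2r ?nnegrE ?(le_trans _ M2)//; exact: m0.
  have S : (Num.sqrt z *+ 2) ^+ N ^+ 2 = 4 ^+ N * z ^+ N.
    rewrite -exprM mulnC exprM -exprMn; congr (_ ^+ N).
    by rewrite -[Num.sqrt z *+ 2]mulr_natr exprMn sqr_sqrtr ?ltW//; ring.
  by rewrite exprMn S -[N.+4]addn4 exprD; rewrite le_eqVlt; apply/orP; left; apply/eqP; ring.
apply: (le_lt_trans G1).
have e1 : e <= 1 by rewrite ge_min lexx.
have : e <= growth_ratio y / (4 ^+ N * 2) by rewrite ge_min lexx orbT.
rewrite ler_pdivlMr ?mulr_gt0//; move: (4 ^+ N) p4 => K p4 h.
by nra.
Qed.

End decay.

(** * The differential inequality at a touching point *)

Section touching_paraboloid.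
Variables (R : realType) (N : nat).
Implicit Types (a x : 'rV[R]_N) (W g : 'rV[R]_N -> R).

(* Testing with (z - |x - a|^2)_+^3 makes z^-(N+4) (\int f (z - |x - a|^2)_+^2)^2
   decreasing in z for f = W - (touching paraboloid) as soon as g a < 2 N al;
   this is impossible since it is nonnegative and tends to 0 at z = 0. *)
Lemma touching_below a (z0 al : R) W g : 0 < z0 -> continuous W -> continuous g ->
  (forall z, 0 < z < z0 -> rint (fun x => g x * wgt a z x ^+ 3) =
                           rint (fun x => W x * lapw a z x)) ->
  (forall x, sqd a x < z0 -> W a - al * dotv a a <= W x - al * dotv x x) ->
  2 * N%:R * al <= g a.
Proof.
move=> z00 cW cg E tch; rewrite leNgt; apply/negP => ga.
set G := 2 * N%:R * al in ga *.
pose q := quad a al (W a); pose f x := W x - q x.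
have cq : continuous q by exact: continuous_quad.
have cf : continuous f by exact: contB.
have qa : q a = W a.
  by rewrite /q -[W a in LHS](subrKC (al * dotv a a)) -quadE subrKC.
have fE x : f x = W x - al * dotv x x - (W a - al * dotv a a).
  by rewrite /f /q -[W a in LHS](subrKC (al * dotv a a)) -quadE; ring.
pose d := (G - g a) / 2.
have d0 : 0 < d by rewrite divr_gt0// subr_gt0.
have : \forall x \near a, g x < G - d.
  have : g @ a --> g a := @cg a; move=> /cvgr_lt; apply; rewrite /d; lra.
move=> /nbhs_sqd[z1 z10 gz1].
apply: (@mom_growth _ _ a f cf (Num.min z0 z1)).
- by rewrite lt_min z00.
- by rewrite /f qa subrr.
- move=> x; rewrite lt_min => /andP[h _]; rewrite fE subr_ge0; exact: tch.
move=> z; rewrite lt_min => /andP[zp /andP[zz0 zz1]].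
have zz : 0 < z < z0 by rewrite zp.
have B3 := rint_wgt_gt0 a 2 zp.
have cG : continuous (fun _ : 'rV[R]_N => G - d) by exact: cont_cst.
have gw : rint (fun x => g x * wgt a z x ^+ 3) <= (G - d) * rint (fun x => wgt a z x ^+ 3).
  rewrite -rint_cst_wgt; apply: le_Rintegral => //.
  - exact: integrable_wgt.
  - exact: (@integrable_wgt _ _ a z (fun=> G - d) 2 cG).
  move=> y _; have [->|/wgt_neq0[h _]] := eqVneq (wgt a z (tvec y)) 0.
    by rewrite exprS mul0r !mulr0.
  rewrite ler_wpM2r ?exprn_ge0 ?wgt_ge0//; apply/ltW/gz1; exact: lt_trans zz1.
have fl : rint (fun x => f x * lapw a z x) =
    rint (fun x => W x * lapw a z x) - rint (fun x => q x * lapw a z x).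
  rewrite /rint -RintegralB//; [|exact: integrable_lapw|exact: integrable_lapw].
  by apply: eq_Rintegral => y _; rewrite /f mulrBl.
have fl0 : rint (fun x => f x * lapw a z x) < 0.
  rewrite fl -E// /q rint_quad_lapw -/G subr_lt0 (le_lt_trans gw)//.
  by rewrite ltr_pM2r// ltrBlDr ltrDl.
(* Divided by 6, this is 4 z mom 1 < (N + 4) mom 2, the inequality excluded by [mom_growth]. *)
move: fl0; rewrite rint_lapw//.
rewrite -[N.+4]addn4 natrD.
by move: (rint _) (rint _) => A B; lra.
Qed.

Lemma touching_above a (z0 al : R) W g : 0 < z0 -> continuous W -> continuous g ->
  (forall z, 0 < z < z0 -> rint (fun x => g x * wgt a z x ^+ 3) =
                           rint (fun x => W x * lapw a z x)) ->
  (forall x, sqd a x < z0 -> W x - al * dotv x x <= W a - al * dotv a a) ->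
  g a <= 2 * N%:R * al.
Proof.
move=> z00 cW cg E tch; rewrite -[leRHS]opprK lerNr -mulrN.
apply: (@touching_below a z0 (- al) (fun x => - W x) (fun x => - g x)) => //.
- by move=> x; apply: continuousN; exact: cW.
- by move=> x; apply: continuousN; exact: cg.
- move=> z zz; have rintN (F : 'rV[R]_N -> R) : (@lebN R N).-integrable setT (EFin \o (F \o @tvec R N)) ->
      rint (fun x => - F x) = - rint F.
    move=> iF; rewrite -mulN1r /rint -RintegralZl//.
    by apply: eq_Rintegral => y _; rewrite mulN1r.
  rewrite (@eq_rint _ _ _ (fun x => - (g x * wgt a z x ^+ 3))); last by move=> x; rewrite mulNr.
  rewrite (@eq_rint _ _ (fun x => - W x * lapw a z x) (fun x => - (W x * lapw a z x))); last by move=> x; rewrite mulNr.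
  rewrite !rintN ?E//; [exact: integrable_lapw|exact: integrable_wgt].
- by move=> x /tch; lra.
Qed.

End touching_paraboloid.

(** * The weak equation tested with a truncated paraboloid *)

Lemma continuous_mx (R : realType) (X : topologicalType) p q (F : X -> 'M[R]_(p, q)) :
  (forall i j, continuous (fun x => F x i j)) -> continuous F.
Proof.
move=> cF; rewrite (_ : F = fun x => \sum_i \sum_j F x i j *: delta_mx i j); last first.
  by apply/funext => x; exact: matrix_sum_delta.
apply: continuous_big => [|i _]; first exact: add_continuous.
apply: continuous_big => [|j _]; first exact: add_continuous.
move=> x; apply: continuousZr_tmp; exact: cF.
Qed.

(** * Balls as admissible domains, with a cubic test function *)

Section paraboloid_test_function.
Variables (R : realType) (N : nat) (a : 'rV[R]_N) (z : R).
Hypothesis z0 : 0 < z.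
Implicit Types (x v : 'rV[R]_N).
Local Notation Omega := [set x | sqd a x < z].

Lemma open_ball_sqd : open Omega.
Proof.
have /continuousP/(_ _ (@open_lt R z)) := @continuous_sqd R N a.
exact.
Qed.

Lemma bdry_ball_sqd x : bdry Omega x -> sqd a x = z.
Proof.
move=> [cx ix]; apply/eqP; rewrite eq_le; apply/andP; split.
  have cl : closed [set x | sqd a x <= z].
    have /continuous_closedP/(_ _ (@closed_le R z)) := @continuous_sqd R N a.
    exact.
  have : closure Omega `<=` [set x | sqd a x <= z].
    by rewrite closureE; apply: smallest_sub => // y /= /ltW.
  exact.
rewrite leNgt; apply/negP => h; apply: ix.
by have /interior_id -> := open_ball_sqd.
Qed.

Lemma sqd_self : sqd a a = 0.
Proof. by rewrite sqdE big1// => i _; rewrite subrr expr0n. Qed.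

Lemma sqd_segment x t : sqd a (a + t *: (x - a)) = t ^+ 2 * sqd a x.
Proof.
rewrite !sqdE mulr_sumr; apply: eq_bigr => i _; rewrite !mxE.
by rewrite -exprMn; congr (_ ^+ 2); ring.
Qed.

Lemma bounded_domain_ball_sqd : bounded_domain Omega.
Proof.
split.
- exact: open_ball_sqd.
- rewrite (_ : Omega = \bigcup_(x in Omega) ((fun t : R => a + t *: (x - a)) @` `[0, 1])).
    apply: bigcup_connected.
      by exists a => x _; exists 0; rewrite ?scale0r ?addr0//= in_itv/= lexx ler01.
    move=> x _; apply: connected_continuous_connected; first exact: segment_connected.
    apply: continuous_subspaceT => t; apply: cvgD; first exact: cvg_cst.
    by apply: cvgZr_tmp; exact: cvg_id.
  apply/seteqP; split => [x xO|y [x /= xO [t]]].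
    by exists x => //; exists 1; rewrite /= ?in_itv/= ?ler01 ?lexx// scale1r subrKC.
  rewrite in_itv/= => /andP[t0 t1] <-; rewrite /= sqd_segment.
  have := sqd_ge0 a x; have : t ^+ 2 <= 1 by rewrite expr_le1.
  rewrite /= in xO; move: (t ^+ 2) => s; nra.
- by exists a; rewrite /= sqd_self.
- exists (supp_radius a z); split; first exact: num_real.
  move=> M hM x /= xz; apply: ltW; apply: le_lt_trans hM.
  rewrite [leLHS]mx_normrE; apply/bigmax_leP; split => [|[i j] _ /=].
    by rewrite /supp_radius !addr_ge0// sumr_ge0.
  by rewrite (ord1 i); exact: sqd_supp.
Qed.

Lemma is_derive_coord x v (j : 'I_N) : is_derive x v (fun y => y ord0 j) (v ord0 j).
Proof.
have H : (fun h : R => h^-1 *: (((fun y : 'rV[R]_N => y ord0 j) \o shift x) (h *: v) - x ord0 j)) @ 0^'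
    --> v ord0 j.
  apply: cvg_near_cst; near=> h.
  have h0 : h != 0 by near: h; exact: nbhs_dnbhs_neq.
  by rewrite /= /shift/= !mxE addrK [LHS]mulKf.
by apply: DeriveDef; [exact: cvgP H|exact: cvg_lim H].
Unshelve. all: by end_near. Qed.

Lemma is_derive_coordB x v (j : 'I_N) :
  is_derive x v (fun y => y ord0 j - a ord0 j) (v ord0 j).
Proof.
have := is_derive_funB (is_derive_coord x v j) (is_derive_fun_cst x v (a ord0 j)).
by rewrite subr0.
Qed.

Lemma is_derive_sqd x v : is_derive x v (sqd a) (2 * dotv (x - a) v).
Proof.
rewrite (_ : sqd a = \sum_(i < N) (fun y : 'rV[R]_N => (y ord0 i - a ord0 i) ^+ 2)); last first.
  by apply/funext => y; rewrite fct_sumE sqdE.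
have H i : is_derive x v (fun y : 'rV[R]_N => (y ord0 i - a ord0 i) ^+ 2)
    (2 * (x ord0 i - a ord0 i) ^+ 1 * v ord0 i).
  exact: (is_derive_funX 1 (is_derive_coordB x v i)).
apply: is_derive_fun_eq (is_derive_sum H) _.
by rewrite /dotv mulr_sumr; apply: eq_bigr => i _; rewrite expr1 !mxE mulrA.
Qed.

Lemma dotv_basis x i : dotv x (basis_vec R i) = x ord0 i.
Proof.
rewrite /dotv (bigD1 i)//= !mxE !eqxx mulr1 big1 ?addr0// => j /negbTE ji.
by rewrite mxE ji andbF mulr0.
Qed.

Lemma grad_sqd x : grad (fun y => sqd a y - z) x = 2 *: (x - a).
Proof.
apply/rowP => i; rewrite !mxE.
have [_ ->] := is_derive_funB (is_derive_sqd x (basis_vec R i)) (is_derive_fun_cst x (basis_vec R i) z).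
by rewrite subr0 dotv_basis !mxE.
Qed.

Lemma differentiable_sqd x : differentiable (fun y => sqd a y - z) x.
Proof.
apply: differentiableB => //.
rewrite (_ : sqd a = \sum_(i < N) (fun y : 'rV[R]_N => (y ord0 i - a ord0 i) ^+ 2)); last first.
  by apply/funext => y; rewrite fct_sumE sqdE.
apply: differentiable_sum => i.
rewrite (_ : (fun _ => _) = (fun y : 'rV[R]_N => y ord0 i - a ord0 i) ^+ 2); last first.
  by rewrite exprfctE.
apply: differentiableX; apply: differentiableB => //.
exact: differentiable_coord.
Qed.

(** A single defining function serves all boundary points. Its gradient vanishes only at the centre,
    which is removed from the neighbourhood; the centre is not on the boundary because z > 0. *)
Lemma C1_boundary_ball_sqd : C1_boundary_normal Omega
  (fun x => (enorm (grad (fun y => sqd a y - z) x))^-1 *: grad (fun y => sqd a y - z) x).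
Proof.
move=> x0 /bdry_ball_sqd x0z; exists (~` [set a]), (fun y => sqd a y - z); split.
- split; last by move=> /= x0a; move: x0z z0; rewrite x0a sqd_self => <-; rewrite ltxx.
  by apply: closed_openC; apply: accessible_closed_set1; exact: hausdorff_accessible (@norm_hausdorff _ _).
- move=> x /= xa; split.
  + exact: differentiable_sqd.
  + rewrite (_ : grad _ = fun y => 2 *: (y - a)); last by apply/funext => y; exact: grad_sqd.
    have cg : continuous (fun y : 'rV[R]_N => 2 *: (y - a)).
      apply: continuous_mx => i j.
      rewrite (_ : (fun _ => _) = fun y : 'rV[R]_N => 2 * (y i j - a i j)); last first.
        by apply/funext => y; rewrite !mxE.
      apply: contM; first exact: cont_cst.
      by apply: contB; [exact: coord_continuous|exact: cont_cst].
    exact: (@cg x).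
  + rewrite grad_sqd scaler_eq0 subr_eq0 pnatr_eq0/=; exact/eqP.
- by move=> x _; rewrite subr_lt0.
- by [].
Qed.

(** The polynomial itself, not its positive part: on the closed ball the two agree, and regularity
    is immediate. With exponent 3 the gradient vanishes on the sphere, which kills the boundary
    flux, and so does the Laplacian, whose extension by zero is thus continuous. *)
Definition tphi x (s : R) : R := (z - sqd a x) ^+ 3.
Definition tDphi x (s : R) : 'rV[R]_N := \row_j (- 6 * (z - sqd a x) ^+ 2 * (x ord0 j - a ord0 j)).
Definition tD2phi x (s : R) : 'M[R]_N :=
  \matrix_(i, j) (24 * (z - sqd a x) * (x ord0 i - a ord0 i) * (x ord0 j - a ord0 j)
                  - 6 * (z - sqd a x) ^+ 2 * (i == j)%:R).

Lemma trace_tD2phi x s : sqd a x < z -> \tr (tD2phi x s) = lapw a z x.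
Proof.
move=> xz; rewrite /lapw wgt_pos// /mxtrace.
transitivity (\sum_(i < N) (24 * (z - sqd a x) * (x ord0 i - a ord0 i) ^+ 2 - 6 * (z - sqd a x) ^+ 2)).
  by apply: eq_bigr => i _; rewrite mxE eqxx mulr1; ring.
rewrite sumrB -mulr_sumr -sqdE sumr_const card_ord -[X in _ - X]mulr_natl.
by ring.
Qed.

Lemma C21_tphi T : C21 Omega T tphi (fun _ _ => 0) tDphi tD2phi.
Proof.
have c1 : continuous (fun y : 'rV[R]_N * R => z - sqd a y.1).
  apply: contB; first exact: cont_cst.
  move=> y; apply: (@continuous_comp _ _ _ fst (sqd a)); first exact: cvg_fst.
  exact: continuous_sqd.
have c2 i : continuous (fun y : 'rV[R]_N * R => y.1 ord0 i - a ord0 i).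
  apply: contB; last exact: cont_cst.
  move=> y; apply: (@continuous_comp _ _ _ fst (fun x : 'rV[R]_N => x ord0 i)); first exact: cvg_fst.
  exact: coord_continuous.
split.
- by apply: continuous_subspaceT; exact: contX.
- by apply: continuous_subspaceT; exact: cont_cst.
- apply: continuous_subspaceT; apply: continuous_mx => i j.
  rewrite (_ : (fun _ => _) = (fun y : 'rV[R]_N * R => - 6 * (z - sqd a y.1) ^+ 2 * (y.1 ord0 j - a ord0 j))); last first.
    by apply/funext => y; rewrite mxE.
  apply: contM; last exact: c2.
  by apply: contM; [exact: cont_cst|exact: contX].
- apply: continuous_subspaceT; apply: continuous_mx => i j.
  rewrite (_ : (fun _ => _) = (fun y : 'rV[R]_N * R =>
      24 * (z - sqd a y.1) * (y.1 ord0 i - a ord0 i) * (y.1 ord0 j - a ord0 j)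
                  - 6 * (z - sqd a y.1) ^+ 2 * (i == j)%:R)); last first.
    by apply/funext => y; rewrite mxE.
  apply: contB.
    apply: contM; last exact: c2.
    by apply: contM; [apply: contM => //; exact: cont_cst|exact: c2].
  apply: contM; last exact: cont_cst.
  by apply: contM; [exact: cont_cst|exact: contX].
- by move=> x t _ _; exact: is_derive_cst.
- move=> x t i _ _.
  apply: is_derive_fun_eq (is_derive_funX 2 (is_derive_funB
    (is_derive_fun_cst x (basis_vec R i) z) (is_derive_sqd x (basis_vec R i)))) _.
  by rewrite dotv_basis !mxE; ring.
- move=> x t i j _ _.
  rewrite (_ : (fun _ => _) = (fun y : 'rV[R]_N => - 6 * (z - sqd a y) ^+ 2 * (y ord0 j - a ord0 j))); last first.
    by apply/funext => y; rewrite mxE.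
  have h := is_derive_funX 1 (is_derive_funB
    (is_derive_fun_cst x (basis_vec R i) z) (is_derive_sqd x (basis_vec R i))).
  apply: is_derive_fun_eq (is_derive_funM
    (is_derive_funM (is_derive_fun_cst x (basis_vec R i) (- 6)) h) (is_derive_coordB x (basis_vec R i) j)) _.
  by rewrite dotv_basis !mxE eqxx [j == i]eq_sym/=; ring.
Qed.

End paraboloid_test_function.

Lemma cont_pair (X Y Z : topologicalType) (f : X -> Y) (g : X -> Z) :
  continuous f -> continuous g -> continuous (fun x => (f x, g x)).
Proof. by move=> cf cg x; exact: (cvg_pair (@cf x) (@cg x)). Qed.

Lemma cont_comp (X Y Z : topologicalType) (f : X -> Y) (g : Y -> Z) :
  continuous f -> continuous g -> continuous (fun x => g (f x)).
Proof. by move=> cf cg x; apply: (@continuous_comp _ _ _ f g); [exact: cf|exact: cg]. Qed.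

Lemma cont_id (X : topologicalType) : continuous (fun x : X => x).
Proof. by move=> x; exact: cvg_id. Qed.

Lemma cont_fst (X Y : topologicalType) : continuous (@fst X Y).
Proof. by move=> x; exact: cvg_fst. Qed.

Lemma cont_snd (X Y : topologicalType) : continuous (@snd X Y).
Proof. by move=> x; exact: cvg_snd. Qed.

(** * Time integrals of jointly continuous functions *)

Section time_integral.
Variables (R : realType) (N : nat) (F : 'rV[R]_N -> R -> R).
Hypothesis cF : continuous (fun y : 'rV[R]_N * R => F y.1 y.2).
Local Notation lambda := (@lebesgue_measure R).
Variable t1 : R.

Definition tint (t : R) (x : 'rV[R]_N) : R := \int[lambda]_(s in `[t1, t]) F x s.

Lemma continuous_time_section x : continuous (F x).
Proof.
have c : continuous (fun s : R => (x, s)).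
  by apply: cont_pair; [move=> s; exact: cvg_cst|exact: cont_id].
exact: (cont_comp c cF).
Qed.

Lemma continuous_space_section s : continuous (F ^~ s).
Proof.
have c : continuous (fun x : 'rV[R]_N => (x, s)).
  by apply: cont_pair; [exact: cont_id|exact: cont_cst].
exact: (cont_comp c cF).
Qed.

Lemma integrable_time_section x t : lambda.-integrable `[t1, t] (EFin \o F x).
Proof.
apply: continuous_compact_integrable; first exact: segment_compact.
by apply: continuous_subspaceT; exact: continuous_time_section.
Qed.

(** Tube argument: compactness of the time interval makes continuity in space uniform in time. *)
Lemma near_time_section x0 t2 eps : 0 < eps ->
  \forall x \near x0, forall s, s \in `[t1, t2] -> `|F x s - F x0 s| <= eps.
Proof.
move=> eps0.
have /compact_near_coveringP/(_ _ (nbhs x0)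
  (fun x s => `|F x s - F x0 s| <= eps) _) H := @segment_compact R t1 t2.
have {H} : \forall x \near x0, `[t1, t2] `<=` (fun s => `|F x s - F x0 s| <= eps).
  apply: H => s _.
  have c1 : continuous (fun y : R * 'rV[R]_N => F y.2 y.1 - F x0 y.1).
    apply: contB.
      exact: (cont_comp (cont_pair (@cont_snd R 'rV[R]_N) (@cont_fst R 'rV[R]_N)) cF).
    exact: (cont_comp (@cont_fst R 'rV[R]_N) (@continuous_time_section x0)).
  have /cvgrPdist_le/(_ eps eps0) := c1 (s, x0).
  rewrite /= subrr; apply: filterS => -[s' x] /=.
  by rewrite sub0r normrN.
by apply: filterS => x H s /H.
Qed.

Lemma tint_dist x x0 t t2 eps : t1 <= t -> t <= t2 -> 
  (forall s, s \in `[t1, t2] -> `|F x s - F x0 s| <= eps) ->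
  `|tint t x - tint t x0| <= eps * (t2 - t1).
Proof.
move=> h1 h2 H.
have iB : lambda.-integrable `[t1, t] (EFin \o (fun s => F x s - F x0 s)).
  have := integrableB _ (integrable_time_section x t) (integrable_time_section x0 t).
  by move=> /(_ (measurable_itv _)); apply: eq_integrable.
have ic : lambda.-integrable `[t1, t] (EFin \o (fun _ : R => eps)).
  apply: continuous_compact_integrable; first exact: segment_compact.
  by apply: continuous_subspaceT; exact: cont_cst.
have eps0 : 0 <= eps.
  by apply: le_trans (H t1 _); rewrite ?normr_ge0// in_itv/= lexx (le_trans h1).
rewrite /tint -RintegralB//; [|exact: integrable_time_section|exact: integrable_time_section].
apply: le_trans (le_normr_Rintegral _ iB) _ => //.
apply: (@le_trans _ _ (\int[lambda]_(s in `[t1, t]) eps)).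
  apply: le_Rintegral => //; first exact: integrable_norm iB.
  move=> s /=; rewrite in_itv/= => /andP[s1 s2]; apply: H.
  by rewrite in_itv/= s1 (le_trans s2).
have E : fine (lambda `[t1, t]%classic) = t - t1.
  rewrite lebesgue_measure_itv/= lte_fin.
  by case: ifPn => h; [rewrite -EFinB|rewrite /=; lra].
rewrite Rintegral_cst// [X in eps * X <= _](_ : _ = t - t1); last exact: E.
by rewrite ler_wpM2l// lerD2r.
Qed.

Lemma continuous_tint t : continuous (tint t).
Proof.
have [h|h] := leP t1 t; last first.
  rewrite (_ : tint t = fun=> 0); first exact: cont_cst.
  apply/funext => x; rewrite /tint set_itv_ge ?Rintegral_set0//.
  by rewrite bnd_simp -ltNge.
move=> x0; apply/(@cvgrPdist_le _ _ _ (nbhs x0)) => eps eps0.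
have e0 : 0 < eps / (t - t1 + 1) by rewrite divr_gt0// ltr_wpDl// subr_ge0.
have := near_time_section x0 t e0.
apply: filterS => x /(tint_dist h (lexx t)).
rewrite distrC => /le_trans; apply.
rewrite mulrAC ler_pdivrMr; last by rewrite ltr_wpDl// subr_ge0.
by rewrite ler_wpM2l ?(ltW eps0)// lerDl.
Qed.

Lemma continuous_tint_joint t2 : t1 <= t2 ->
  {within setT `*` `[t1, t2], continuous (fun y : 'rV[R]_N * R => tint y.2 y.1)}.
Proof.
move=> t12; apply/subspace_continuousP => -[x0 t0] /= [_].
rewrite in_itv/= => ht0; have /andP[h1 h2] := ht0.
apply/(@cvgrPdist_le _ _ _ (within (setT `*` `[t1, t2]) (nbhs (x0, t0)))) => /= eps eps0.
have e0 : 0 < eps / 2 / (t2 - t1 + 1).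
  by rewrite divr_gt0 ?divr_gt0// ltr_wpDl// subr_ge0.
have nx : \forall y \near (x0, t0), forall s, s \in `[t1, t2] ->
    `|F y.1 s - F x0 s| <= eps / 2 / (t2 - t1 + 1).
  exact: (@cvg_fst _ _ (nbhs x0) (nbhs t0) _ _ (near_time_section x0 t2 e0)).
have nt : \forall y \near (x0, t0), y.2 \in `[t1, t2] ->
    `|tint t0 x0 - tint y.2 x0| <= eps / 2.
  have := @parameterized_integral_continuous R t1 t2 (F x0) t12 (integrable_time_section x0 t2).
  move=> /subspace_continuousP/(_ t0); rewrite /= in_itv/= => /(_ ht0).
  move=> /cvgrPdist_le/(_ (eps / 2)); rewrite divr_gt0// => /(_ isT) nt.
  exact: (@cvg_snd _ _ (nbhs x0) (nbhs t0) _ _ nt).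
rewrite /within; apply: filterS2 nx nt => y nx nt [_ hy].
have hy2 : t1 <= y.2 <= t2 by move: hy; rewrite /= in_itv.
have /andP[h3 h4] := hy2.
have d1 := nt hy.
have d2 := tint_dist h3 h4 nx.
have d3 : eps / 2 / (t2 - t1 + 1) * (t2 - t1) <= eps / 2.
  rewrite mulrAC ler_pdivrMr; last by rewrite ltr_wpDl// subr_ge0.
  by rewrite ler_wpM2l ?divr_ge0 ?(ltW eps0)// lerDl.
suff : `|tint t0 x0 - tint y.2 y.1| <= eps by [].
move: d1 d2 d3; move: (tint y.2 x0) (tint y.2 y.1) (_ * (t2 - t1)) => A B C d1 d2 d3.
have := ler_normD (tint t0 x0 - A) (A - B); rewrite subrKA [`|A - B|]distrC /=.
lra.
Qed.

Lemma is_derive_tint t x : t1 < t -> is_derive t (1 : R) (tint ^~ x) (F x t).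
Proof.
move=> h.
have tt : t < t + 1 by rewrite ltrDl.
have [dt ft] := continuous_FTC1_closed tt (integrable_time_section x (t + 1)) h
  (@continuous_time_section x t).
by apply: DeriveDef; [exact: dt|rewrite -derive1E; exact: ft].
Qed.

Lemma tint_self x : tint t1 x = 0.
Proof. by rewrite /tint /Rintegral set_itv1 integral_set1. Qed.

(** For joint measurability the integrand is read as a continuous function [H] of N + 1 variables
    with time as head coordinate, so that [measurable_tvec] applies; the time interval enters as an
    indicator factor. *)
Lemma Fubini_tint a z k t : t1 <= t ->
  \int[lambda]_(s in `[t1, t]) rint (fun x => F x s * wgt a z x ^+ k.+1) =
  rint (fun x => tint t x * wgt a z x ^+ k.+1).
Proof.
move=> t1t.
pose H (v : 'rV[R]_N.+1) : R := F (\row_i v ord0 (lift ord0 i)) (v ord0 ord0)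
   * wgt a z (\row_i v ord0 (lift ord0 i)) ^+ k.+1.
have crow : continuous (fun v : 'rV[R]_N.+1 => (\row_i v ord0 (lift ord0 i)) : 'rV[R]_N).
  apply: continuous_mx => i j; rewrite (_ : (fun _ => _) = fun v : 'rV[R]_N.+1 => v ord0 (lift ord0 j)).
    exact: coord_continuous.
  by apply/funext => v; rewrite mxE.
have cH : continuous H.
  apply: contM.
    exact: (cont_comp (cont_pair crow (@coord_continuous _ _ _ ord0 ord0)) cF).
  by apply: contX; exact: (cont_comp crow (@continuous_wgt _ _ a z)).
have rowE (y : N.-tuple (measurableTypeR R)) (s : R) :
    (\row_i tvec (consp (y, s)) ord0 (lift ord0 i)) = tvec y.
  by apply/rowP => i; rewrite !mxE tnthS.
have HE y s : H (tvec (consp (y, s))) = F (tvec y) s * wgt a z (tvec y) ^+ k.+1.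
  by rewrite /H rowE mxE.
pose f (y : N.-tuple (measurableTypeR R) * measurableTypeR R) : R :=
  H (tvec (consp y)) * \1_`[t1, t]%classic y.2.
have mf : measurable_fun setT f.
  apply: measurable_funM.
    apply: (measurableT_comp (measurable_tvec cH)); exact: measurable_consp.
  have mI : measurable_fun setT (\1_(`[t1, t]%classic : set R) : measurableTypeR R -> R).
    exact: measurable_indic.
  exact: (measurableT_comp mI (@measurable_snd _ _ (N.-tuple (measurableTypeR R)) _)).
pose L := Num.max (supp_radius a z) (`|t1| + `|t|).
have [M HM] := continuous_bounded_cube L cH.
have f0 y : ~ (cube (fun=> 0) (supp_radius a z) `*` `[t1, t]) y -> f y = 0.
  move: y => [y s] n; rewrite /f HE indicE.
  have [sI|sI] := boolP (s \in `[t1, t]%classic); last by rewrite mulr0.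
  rewrite mulr1; have [->|/wgt_neq0[h _]] := eqVneq (wgt a z (tvec y)) 0.
    by rewrite exprS mul0r mulr0.
  exfalso; apply: n; split => /=; last by move: sI; rewrite inE.
  move=> i; rewrite sub0r add0r -ler_norml.
  by have := sqd_supp i h; rewrite mxE.
have fM y : `|f y| <= Num.max 0 M.
  have [[h1 h2]|/f0 ->] := pselect ((cube (fun=> 0) (supp_radius a z) `*` `[t1, t]) y); last first.
    by rewrite normr0 le_max lexx.
  rewrite /f indicE mem_set// mulr1 le_max; apply/orP; right; apply: HM => i.
  rewrite mxE le_max; case: (unliftP ord0 i) => [j ->|->].
    by rewrite tnthS; have := h1 j; rewrite sub0r add0r -ler_norml => ->.
  apply/orP; right; have : t1 <= y.2 <= t by move: h2; rewrite /= in_itv.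
  move=> /andP[h3 h4]; rewrite ler_norml; change (tnth (consp y) ord0) with y.2.
  move: h3 h4; move: y.2 => s h3 h4.
  have := ler_norm t; have := ler_norm (- t1); rewrite normrN.
  have := normr_ge0 t; have := normr_ge0 t1.
  by move=> *; apply/andP; split; lra.
have intf : (@lebN R N \x lambda)%E.-integrable setT (EFin \o f).
  apply: (@integrable_bounded_support _ _ _ (@lebN R N \x lambda)%E
    (cube (fun=> 0) (supp_radius a z) `*` `[t1, t]) f (Num.max 0 M)) => //.
  - by apply: measurableX => //; exact: measurable_cube.
  - have := @product_measure1E _ _ _ _ _ (@lebN R N) lambda (cube (fun=> 0) (supp_radius a z)) `[t1, t]
      (measurable_cube _ _) (measurable_itv _).
    move=> /= ->; rewrite lte_mul_pinfty//.
      by rewrite ge0_fin_numE//; exact: lebesgue_tuple_cube_lty.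
    by rewrite lebesgue_measure_itv; case: ifP => //=; rewrite ltry.
have := Fubini intf; rewrite /rint /Rintegral => FF.
congr fine; apply: esym.
transitivity (\int[@lebN R N]_y \int[lambda]_s (f (y, s))%:E)%E.
  apply: eq_integral => y _.
  rewrite (_ : (fun s => (f (y, s))%:E) = (EFin \o (fun s => F (tvec y) s * wgt a z (tvec y) ^+ k.+1)) \_ `[t1, t]).
    rewrite -integral_mkcond/= /tint -RintegralZr//; last exact: integrable_time_section.
    rewrite /Rintegral fineK//; apply: integrable_fin_num => //.
    have := integrableZr _ (wgt a z (tvec y) ^+ k.+1) (integrable_time_section (tvec y) t).
    by move=> /(_ (measurable_itv _)); apply: eq_integrable => // s _ /=; rewrite EFinM.
  apply/funext => s; rewrite /patch /f HE /= indicE; case: (s \in _) => /=; first by rewrite mulr1.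
  by rewrite mulr0.
rewrite FF [RHS]integral_mkcond; apply: eq_integral => s _.
rewrite /patch; case: ifPn => hs; last first.
  by rewrite integral0_eq// => y _; rewrite /f /= indicE (negbTE hs) mulr0.
rewrite fineK.
  by apply: eq_integral => y _; rewrite /f /= HE indicE hs mulr1.
apply: integrable_fin_num => //.
apply: (@integrable_wgt _ _ a z (fun x => F x s)); exact: continuous_space_section.
Qed.

End time_integral.

(** The positive part shields the function from the values of [powR] at negative bases; at 0 the
    modulus of continuity is eps^(1/r). *)
Lemma continuous_pospart_powR (R : realType) (r : R) : 0 < r ->
  continuous (fun t : R => Num.max 0 t `^ r).
Proof.
move=> r0 t; have [t0|t0|t0] := ltgtP t 0.
- have h := @cont_cst R R (Num.max 0 t `^ r) t; apply: cvg_trans h.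
  apply: near_eq_cvg; near=> s.
  have s0 : s < 0 by near: s; exact: lt_nbhsl.
  by rewrite !max_l// ltW.
- have h : (fun t : R => t `^ r) @ t --> t `^ r.
    have [dt _] := is_derive1_powR r t0.
    by move: dt => /derivable1_diffP/differentiable_continuous.
  suff : (fun t : R => Num.max 0 t `^ r) @ t --> Num.max 0 t `^ r by [].
  have -> : Num.max 0 t = t by rewrite max_r// ltW.
  apply: cvg_trans h.
  apply: near_eq_cvg; near=> s.
  have s0 : 0 < s by near: s; exact: lt_nbhsr.
  by rewrite max_r// ltW.
- suff : (fun t : R => Num.max 0 t `^ r) @ t --> Num.max 0 t `^ r by [].
  rewrite t0 maxxx powR0 ?gt_eqF//; apply/(@cvgrPdist_le _ _ _ (nbhs (0 : R))) => eps eps0.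
  have e0 : 0 < eps `^ r^-1 by rewrite powR_gt0.
  have H : \forall s \near nbhs (0 : R), `|s| <= eps `^ r^-1.
    by apply/nbhs_ballP; exists (eps `^ r^-1) => //= s; rewrite /ball/= sub0r normrN => /ltW.
  apply: filterS H => s H; rewrite sub0r normrN ger0_norm ?powR_ge0//.
  have : Num.max 0 s <= eps `^ r^-1.
    by rewrite ge_max powR_ge0/=; exact: le_trans (ler_norm s) H.
  have E : eps = (eps `^ r^-1) `^ r.
    by rewrite -powRrM mulVf ?gt_eqF// powRr1// ltW.
  move=> h; rewrite [leRHS]E; apply: (ge0_ler_powR (ltW r0)) => //.
    by rewrite nnegrE le_max lexx.
  by rewrite nnegrE powR_ge0.
Unshelve. all: by end_near. Qed.

(** * The weak equation for the time integrals *)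

Section weak_identity.
Variables (R : realType) (N : nat) (m p sigma T : R).
Variables (u0 : 'rV[R]_N -> R) (u : 'rV[R]_N -> R -> R).
Hypotheses (m0 : 0 < m) (p0 : 0 < p) (sigma0 : 0 < sigma).
Hypothesis hw : weak_solution m p sigma u0 T u.
Variables t1 t2 : R.
Hypotheses (t10 : 0 < t1) (t12 : t1 <= t2) (t2T : t2 < T).
Local Notation lambda := (@lebesgue_measure R).

(* Freezing time outside [t1, t2] makes u continuous on all of R^N x R. *)
Definition uclamp x s := u x (Num.max t1 (Num.min s t2)).
Definition upow r x s := Num.max 0 (uclamp x s) `^ r.

Lemma clamp_id s : s \in `[t1, t2] -> Num.max t1 (Num.min s t2) = s.
Proof. by rewrite in_itv/= => /andP[h1 h2]; rewrite min_l// max_r. Qed.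

Lemma upowE r x s : s \in `[t1, t2] -> upow r x s = u x s `^ r.
Proof.
move=> h; rewrite /upow /uclamp clamp_id// max_r//.
apply: (weak_ge0 hw); move: h; rewrite in_itv/= => /andP[h1 h2].
by rewrite (lt_le_trans t10)//= (le_lt_trans h2).
Qed.

Lemma continuous_uclamp : continuous (fun y : 'rV[R]_N * R => uclamp y.1 y.2).
Proof.
(* Continuity of u is given on open time intervals ]0, t[ with t < T; the clamped time stays in
   [t1, t2], inside ]0, t3[. *)
pose t3 := (t2 + T) / 2.
have t23 : t2 < t3 by move: t2T; rewrite /t3; lra.
have t3T : 0 < t3 < T.
  have t20 := lt_le_trans t10 t12.
  by move: t2T => h; apply/andP; rewrite /t3; split; lra.
have oA : open (setT `*` `]0, t3[%classic : set ('rV[R]_N * R)).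
  rewrite (_ : _ `*` _ = snd @^-1` (`]0, t3[%classic : set R)).
    by have /continuousP := @cont_snd 'rV[R]_N R; apply; exact: interval_open.
  by apply/seteqP; split => [[x s] []|[x s]].
have := weak_cont hw t3T.
rewrite /continuous_on (continuous_open_subspace _ oA) => cu.
have cc : continuous (fun y : 'rV[R]_N * R => (y.1, Num.max t1 (Num.min y.2 t2))).
  apply: cont_pair; first exact: cont_fst.
  apply: cont_max; first exact: cont_cst.
  by move=> y; apply: continuous_min; [exact: cont_snd|exact: cvg_cst].
move=> y; apply: (@continuous_comp _ _ _
  (fun y : 'rV[R]_N * R => (y.1, Num.max t1 (Num.min y.2 t2))) (fun y => u y.1 y.2)).
  exact: cc.
apply: cu; rewrite inE; split => //=; rewrite in_itv/=.
have h1 : t1 <= Num.max t1 (Num.min y.2 t2) by rewrite le_max lexx.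
have h2 : Num.max t1 (Num.min y.2 t2) <= t2 by rewrite ge_max t12 ge_min lexx orbT.
by rewrite (lt_le_trans t10 h1) (le_lt_trans h2 t23).
Qed.

Lemma continuous_upow r : 0 < r ->
  continuous (fun y : 'rV[R]_N * R => upow r y.1 y.2).
Proof. by move=> r0; exact: (cont_comp continuous_uclamp (continuous_pospart_powR r0)). Qed.

Lemma continuous_uslice s : s \in `[t1, t2] -> continuous (u ^~ s).
Proof.
move=> h; rewrite (_ : u ^~ s = uclamp ^~ s).
  exact: (continuous_space_section continuous_uclamp).
by apply/funext => x; rewrite /uclamp clamp_id.
Qed.

Lemma continuous_enorm_powR : continuous (fun x : 'rV[R]_N => enorm x `^ sigma).
Proof.
have := cont_comp (cont_comp (@continuous_sqd R N 0) (@sqrt_continuous R)) (continuous_pospart_powR sigma0).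
rewrite (_ : (fun x => Num.max 0 _ `^ sigma) = (fun x => enorm x `^ sigma))//.
by apply/funext => x; rewrite max_r ?sqrtr_ge0// /sqd subr0.
Qed.

Lemma spaceint_ball a z (f g : 'rV[R]_N -> R) :
  (forall x, sqd a x < z -> f x = g x) -> (forall x, z <= sqd a x -> g x = 0) ->
  spaceint [set x | sqd a x < z] f = rint g.
Proof.
move=> fg g0; rewrite /spaceint Rintegral_mkcond; apply: eq_Rintegral => y _.
rewrite /patch; case: ifPn => [|/negP]; first by rewrite inE => /fg.
by rewrite inE /= => /negP; rewrite -leNgt => /g0 ->.
Qed.

Lemma bdry_flux_tphi a z nu s : bdry_flux m [set x | sqd a x < z] nu u (tDphi a z) s = 0.
Proof.
rewrite /bdry_flux /surfint.
rewrite (@eq_Rintegral _ _ _ _ _ (fun=> 0)).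
  by rewrite /Rintegral integral0_eq.
move=> x /set_mem/bdry_ball_sqd xz.
by rewrite /dotv big1 ?mulr0// => i _; rewrite mxE xz subrr expr0n/= mulr0 !mul0r.
Qed.

(** The flux integrand with one factor of the weight split off, so that [Fubini_tint] applies with k
    = 0. *)
Definition flux_density a z x s := (24 * z - (6 * N%:R + 24) * wgt a z x) * upow m x s
  + enorm x `^ sigma * wgt a z x ^+ 2 * upow p x s.

Lemma pde_flux_tphi a z s : s \in `[t1, t2] ->
  pde_flux m p sigma [set x | sqd a x < z] u (tphi a z) (fun _ _ => 0) (tD2phi a z) s =
  rint (fun x => flux_density a z x s * wgt a z x ^+ 1).
Proof.
move=> sI; apply: spaceint_ball => x xz; last by rewrite wgt0// expr1 mulr0.
rewrite mulr0 add0r trace_tD2phi// /lapw /flux_density !upowE//.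
by rewrite /tphi wgt_pos// expr1; ring.
Qed.

Lemma continuous_flux_density a z :
  continuous (fun y : 'rV[R]_N * R => flux_density a z y.1 y.2).
Proof.
have cw := cont_comp (@cont_fst 'rV[R]_N R) (@continuous_wgt R N a z).
rewrite /flux_density; apply: contD; apply: contM.
- by apply: contB; [exact: cont_cst|apply: contM => //; exact: cont_cst].
- exact: (continuous_upow m0).
- apply: contM; last exact: contX.
  exact: (cont_comp (@cont_fst 'rV[R]_N R) continuous_enorm_powR).
- exact: (continuous_upow p0).
Qed.

Lemma tint_flux_density a z t x : tint (flux_density a z) t1 t x =
  (24 * z - (6 * N%:R + 24) * wgt a z x) * tint (upow m) t1 t x
  + enorm x `^ sigma * wgt a z x ^+ 2 * tint (upow p) t1 t x.
Proof.
have im := integrable_time_section (continuous_upow m0) t1 x t.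
have ip := integrable_time_section (continuous_upow p0) t1 x t.
have mI : measurable (`[t1, t]%classic : set (measurableTypeR R)) by exact: measurable_itv.
rewrite /tint -!RintegralZl// -RintegralD//.
- have := integrableZl mI (24 * z - (6 * N%:R + 24) * wgt a z x) im.
  by apply: eq_integrable => // s _ /=; rewrite EFinM.
- have := integrableZl mI (enorm x `^ sigma * wgt a z x ^+ 2) ip.
  by apply: eq_integrable => // s _ /=; rewrite EFinM.
Qed.

(** Subtracting the weak equation at [t1] from that at [t] removes the initial datum and leaves time
    integrals over [t1, t], where u is jointly continuous and Fubini applies. The test function does
    not depend on time, so no term with its time derivative survives. *)
Lemma weak_identity a z t : 0 < z -> t \in `[t1, t2] ->
  rint (fun x => (u x t - u x t1 - enorm x `^ sigma * tint (upow p) t1 t x) * wgt a z x ^+ 3) =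
  rint (fun x => tint (upow m) t1 t x * lapw a z x).
Proof.
move=> z0 tI.
have /andP[h1 h2] : t1 <= t <= t2 by rewrite in_itv in tI.
have t1I : t1 \in `[t1, t2] by rewrite in_itv/= lexx.
have t1T : 0 < t1 < T by rewrite t10 (le_lt_trans t12).
have tT : 0 < t < T by rewrite (lt_le_trans t10)// (le_lt_trans h2).
have bzero x s : bdry [set x | sqd a x < z] x -> 0 < s < T -> tphi a z x s = 0.
  by move=> /bdry_ball_sqd xz _; rewrite /tphi xz subrr expr0n.
have W := weak_eq hw (bounded_domain_ball_sqd a z0) (C1_boundary_ball_sqd z0)
  (C21_tphi a z T) bzero.
have [iF _ Et] := W t tT; have [iF1 _ Et1] := W t1 t1T.
move: Et Et1.
under [X in _ = _ - X -> _]eq_Rintegral do rewrite bdry_flux_tphi.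
under [X in _ -> _ = _ - X -> _]eq_Rintegral do rewrite bdry_flux_tphi.
have z_int D : \int[lambda]_(s in D) (0 : R) = 0 by rewrite /Rintegral integral0_eq.
rewrite !z_int !subr0 => Et Et1.
have E3 s : spaceint [set x | sqd a x < z] (fun x => u x s * tphi a z x s) =
    rint (fun x => u x s * wgt a z x ^+ 3).
  apply: spaceint_ball => x xz; first by rewrite /tphi wgt_pos.
  by rewrite wgt0// expr0n/= mulr0.
rewrite !E3 in Et Et1.
set Fl := pde_flux _ _ _ _ _ _ _ _ in iF iF1 Et Et1.
have D : rint (fun x => u x t * wgt a z x ^+ 3) - rint (fun x => u x t1 * wgt a z x ^+ 3) =
    \int[lambda]_(s in `]0, t[) Fl s - \int[lambda]_(s in `]0, t1[) Fl s.
  by rewrite -Et -Et1; ring.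
have DF : \int[lambda]_(s in `]0, t[) Fl s - \int[lambda]_(s in `]0, t1[) Fl s =
   \int[lambda]_(s in `[t1, t]) Fl s.
  move: (h1); rewrite le_eqVlt => /predU1P[<-|h1t].
    by rewrite subrr set_itv1 Rintegral_set1.
  rewrite (Rintegral_itv_bndo_bndc iF1) (Rintegral_itvB iF); last 2 first.
  - by rewrite bnd_simp ltW.
  - by rewrite bnd_simp.
  have i1 : lambda.-integrable `]t1, t[ (EFin \o Fl).
    apply: integrableS iF => //; apply: subset_itvr.
    by rewrite bnd_simp ltW.
  rewrite (Rintegral_itv_obnd_cbnd i1) Rintegral_itv_bndo_bndc//.
  apply: integrableS iF => //; apply: subset_itvr.
  by rewrite bnd_simp.
have FF : \int[lambda]_(s in `[t1, t]) Fl s =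
    rint (fun x => tint (flux_density a z) t1 t x * wgt a z x ^+ 1).
  apply: etrans (@Fubini_tint R N _ (@continuous_flux_density a z) t1 a z 0 t h1).
  apply: eq_Rintegral => s; rewrite inE/= => sI; apply: pde_flux_tphi.
  by move: sI; rewrite !in_itv/= => /andP[-> s2]; exact: le_trans h2.
have ct := continuous_uslice tI; have ct1 := continuous_uslice t1I.
have cm := @continuous_tint R N _ (continuous_upow m0) t1 t.
have cp := @continuous_tint R N _ (continuous_upow p0) t1 t.
have cS : continuous (fun x => enorm x `^ sigma * tint (upow p) t1 t x).
  by apply: contM => //; exact: continuous_enorm_powR.
have il := integrable_lapw a z cm.
have iS := integrable_wgt a z 2 cS.
have it := integrable_wgt a z 2 ct.
have it1 := integrable_wgt a z 2 ct1.
have itt := integrable_wgt a z 2 (contB ct ct1).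
transitivity (rint (fun x => (u x t - u x t1) * wgt a z x ^+ 3) -
    rint (fun x => (enorm x `^ sigma * tint (upow p) t1 t x) * wgt a z x ^+ 3)).
  rewrite /rint -RintegralB//; apply: eq_Rintegral => y _; exact: mulrBl.
transitivity (rint (fun x => u x t * wgt a z x ^+ 3) - rint (fun x => u x t1 * wgt a z x ^+ 3) -
    rint (fun x => (enorm x `^ sigma * tint (upow p) t1 t x) * wgt a z x ^+ 3)).
  congr (_ - _); rewrite /rint -RintegralB//; apply: eq_Rintegral => y _; exact: mulrBl.
rewrite D DF FF.
transitivity (rint (fun x => tint (upow m) t1 t x * lapw a z x) +
    rint (fun x => (enorm x `^ sigma * tint (upow p) t1 t x) * wgt a z x ^+ 3) -
    rint (fun x => (enorm x `^ sigma * tint (upow p) t1 t x) * wgt a z x ^+ 3)); last exact: addrK.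
congr (_ - _); rewrite /rint -RintegralD//; apply: eq_Rintegral => y _.
by rewrite tint_flux_density /lapw expr1; ring.
Qed.

End weak_identity.

(** * Barriers *)

(** Only earlier times are compared, because the space-time minimum may be attained at the final
    time. *)
Lemma left_min_derive_le0 (R : realType) (D : R -> R) (t1 t d : R) : t1 < t ->
  is_derive t (1 : R) D d -> (forall s, s \in `[t1, t] -> D t <= D s) -> d <= 0.
Proof.
move=> t1t [dD <-] H; rewrite leNgt; apply/negP => d0.
have cD : (fun h => h^-1 *: (D (h *: (1 : R) + t) - D t)) @ 0^'- --> 'D_1 D t.
  exact: cvg_dnbhs_at_left dD.
have : \forall h \near 0^'-, 0 < h^-1 *: (D (h *: (1 : R) + t) - D t).
  by move/cvgr_gt : cD; exact.
move=> H2.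
have : \forall h \near (0 : R)^'-, False.
  near=> h.
  have h0 : h < 0 by near: h; exact: nbhs_left_lt.
  have ht : t1 - t < h by near: h; apply: nbhs_left_gt; rewrite subr_lt0.
  have : 0 < h^-1 *: (D (h *: (1 : R) + t) - D t) by near: h.
  rewrite [_ *: _]/(_ * _) [h *: 1]mulr1 nmulr_rgt0 ?invr_lt0// subr_lt0 ltNge H//.
  by rewrite in_itv/=; apply/andP; split; lra.
by move=> /filter_ex[].
Unshelve. all: by end_near. Qed.

(** * The time factor of the barrier *)

Section blowup_profile.
Variables (R : realType) (T kappa m : R).
Hypothesis (km : kappa * m = kappa + 1).

(** The hypothesis [km] means kappa = 1 / (m - 1). Then tau' = kappa tau^m, the same power of tau as
    in W_t = u^m when u is comparable to tau. *)
Definition profile (s : R) : R := (T - s) `^ (- kappa).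

Lemma profile_gt0 s : s < T -> 0 < profile s.
Proof. by move=> sT; rewrite powR_gt0// subr_gt0. Qed.

Lemma is_derive_profile s : s < T -> is_derive s (1 : R) profile (kappa * profile s `^ m).
Proof.
move=> sT; have Ts : 0 < T - s by rewrite subr_gt0.
have d1 := is_derive1_powR (- kappa) Ts.
have d2 : is_derive s (1 : R) (fun s : R => T - s) (0 - 1).
  by apply: is_derive_funB; exact: is_derive_cst.
apply: is_derive_fun_eq (@is_derive1_comp _ (fun t => t `^ (- kappa)) (fun s => T - s) s _ _ d1 d2) _.
have -> : profile s `^ m = (T - s) `^ (- kappa - 1).
  by rewrite /profile -powRrM mulNr km opprD.
by rewrite sub0r mulrN1 mulNr opprK.
Qed.

Lemma continuous_profile s : s < T -> {for s, continuous profile}.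
Proof.
move=> /is_derive_profile[dp _].
by move: dp => /derivable1_diffP/differentiable_continuous.
Qed.

Lemma profile_unbounded K t1 : 0 < kappa -> t1 < T ->
  exists2 t, t1 <= t < T & K < profile t.
Proof.
move=> k0 t1T; pose K1 := `|K| + 1.
have K10 : 0 < K1 by rewrite ltr_wpDl.
(* The second entry is the remaining time at which the profile equals K1. *)
pose d := Num.min (T - t1) (K1 `^ (- kappa^-1)).
have d0 : 0 < d by rewrite lt_min subr_gt0 t1T powR_gt0.
have dt : d <= T - t1 by rewrite ge_min lexx.
exists (T - d); first by apply/andP; split; lra.
rewrite /profile subKr; apply: (@lt_le_trans _ _ K1).
  by rewrite (le_lt_trans (ler_norm K))// ltrDl.
have dK : d <= K1 `^ (- kappa^-1) by rewrite ge_min lexx orbT.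
have E : K1 = (K1 `^ (- kappa^-1)) `^ (- kappa).
  by rewrite -powRrM mulrNN mulVf ?gt_eqF// powRr1// ltW.
move: dK E; have : 0 < K1 `^ (- kappa^-1) by rewrite powR_gt0.
move: (K1 `^ _) => e e0 de ->.
rewrite !powRN lef_pV2 ?posrE ?powR_gt0//.
by apply: (ge0_ler_powR (ltW k0)) => //; rewrite nnegrE ltW.
Qed.

End blowup_profile.

(** * Lower bound for W inside the sphere *)

Section comparison.
Variables (R : realType) (N : nat) (m p sigma T : R).
Variables (u0 : 'rV[R]_N -> R) (u : 'rV[R]_N -> R -> R).
Hypotheses (m0 : 0 < m) (p0 : 0 < p) (sigma0 : 0 < sigma).
Hypothesis hw : weak_solution m p sigma u0 T u.
Variables t1 t2 : R.
Hypotheses (t10 : 0 < t1) (t12 : t1 <= t2) (t2T : t2 < T).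
Local Notation lambda := (@lebesgue_measure R).
Local Notation W r := (tint (upow u t1 t2 r) t1).
Local Notation g t := (fun x => u x t - u x t1 - enorm x `^ sigma * W p t x).

Lemma compact_ball_dotv r : compact [set x : 'rV[R]_N | dotv x x <= r].
Proof.
have E : [set x : 'rV[R]_N | dotv x x <= r] = [set x | sqd 0 x <= r].
  by apply/seteqP; split => x; rewrite /= /sqd subr0.
rewrite E; apply: bounded_closed_compact.
  exists (supp_radius (0 : 'rV[R]_N) (r + 1)); split; first exact: num_real.
  move=> M hM x /= xr; apply: ltW; apply: le_lt_trans hM.
  rewrite [leLHS]mx_normrE; apply/bigmax_leP; split => [|[i j] _ /=].
    by rewrite /supp_radius !addr_ge0// sumr_ge0.
  by rewrite (ord1 i); apply: sqd_supp; rewrite (le_lt_trans xr)// ltrDl.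
have /continuous_closedP/(_ _ (@closed_le R r)) := @continuous_sqd R N 0.
exact.
Qed.

Lemma continuous_dotv : continuous (fun x : 'rV[R]_N => dotv x x).
Proof.
have := @continuous_sqd R N 0.
by rewrite (_ : sqd 0 = fun x => dotv x x)//; apply/funext => x; rewrite /sqd subr0.
Qed.

Lemma dotv_nbhs (a : 'rV[R]_N) r : dotv a a < r ->
  exists2 z, 0 < z & forall x, sqd a x < z -> dotv x x < r.
Proof.
move=> ar; apply: (@nbhs_sqd _ _ _ [set x | dotv x x < r]).
apply: open_nbhs_nbhs; split => //.
have /continuousP/(_ _ (@open_lt R r)) := continuous_dotv.
exact.
Qed.

Lemma tint_upow_ge0 r t x : 0 <= W r t x.
Proof. by apply: Rintegral_ge0 => s _; rewrite powR_ge0. Qed.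

Lemma continuous_g t : t \in `[t1, t2] -> continuous (g t).
Proof.
move=> tI; apply: contB.
  have t1I : t1 \in `[t1, t2] by rewrite in_itv/= lexx.
  by apply: contB; apply: (continuous_uslice hw t10 t12 t2T).
apply: contM; first exact: continuous_enorm_powR.
exact: (@continuous_tint R N _ (continuous_upow hw t10 t12 t2T p0) t1 t).
Qed.

Lemma u_ge0 x s : s \in `[t1, t2] -> 0 <= u x s.
Proof.
rewrite in_itv/= => /andP[h1 h2]; apply: (weak_ge0 hw).
by rewrite (lt_le_trans t10 h1) (le_lt_trans h2 t2T).
Qed.

(** Here [r] is a squared radius. The subtracted constant makes the barrier nonpositive at t1, where
    W vanishes. At a minimum (a, t) with t > t1 the time derivative of the difference is at least
    tau^m ((2 N al)^m - kappa (al r + 1)) > 0, contrary to minimality among earlier times. *)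
Lemma inner_comparison kappa al r : 0 < al ->
  kappa * m = kappa + 1 -> 0 < kappa ->
  kappa * (al * r + 1) < (2 * N%:R * al) `^ m ->
  0 <= r -> (exists x1 : 'rV[R]_N, dotv x1 x1 = r) ->
  (forall x s, s \in `[t1, t2] -> dotv x x = r -> 2 * N%:R * al * profile T kappa s <= u x s) ->
  forall x, dotv x x <= r ->
    profile T kappa t2 * (al * dotv x x + 1) - profile T kappa t1 * (al * r + 1) <= W m t2 x.
Proof.
move=> al0 km k0 hal r0 [x1 x1r] Hb x xr.
pose tau := profile T kappa.
have cW := continuous_tint_joint (continuous_upow hw t10 t12 t2T m0) t12.
pose K : set ('rV[R]_N * R) := [set x | dotv x x <= r] `*` `[t1, t2].
have cK : compact K by apply: compact_setX; [exact: compact_ball_dotv|exact: segment_compact].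
pose f (y : 'rV[R]_N * R) := W m y.2 y.1 - tau y.2 * (al * dotv y.1 y.1 + 1).
have cf : {within K, continuous f}.
  have c1 : {within K, continuous (fun y : 'rV[R]_N * R => W m y.2 y.1)}.
    by apply: continuous_subspaceW cW => -[y s] [].
  have c2 : {within K, continuous (fun y : 'rV[R]_N * R => tau y.2 * (al * dotv y.1 y.1 + 1))}.
    apply: continuous_in_subspaceT => -[y s]; rewrite inE => -[_ /=].
    rewrite in_itv/= => /andP[_ sT].
    have ca : {for (y, s), continuous (fun y : 'rV[R]_N * R => tau y.2)}.
      apply: continuous_comp; first exact: cont_snd.
      by apply: (@continuous_profile R T kappa m km); exact: le_lt_trans sT t2T.
    have cb : continuous (fun y : 'rV[R]_N * R => al * dotv y.1 y.1 + 1).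
      apply: contD; last exact: cont_cst.
      apply: contM; first exact: cont_cst.
      exact: (cont_comp (@cont_fst 'rV[R]_N R) continuous_dotv).
    exact: (continuousM ca (@cb (y, s))).
  by move=> y; exact: (continuousB (@c1 y) (@c2 y)).
have K0 : K !=set0 by exists (x1, t1); split => /=; rewrite ?x1r// in_itv/= lexx.
have [[a t]] := compact_EVT_min K0 cK cf.
rewrite inE => -[/= ar tI] minf.
have ht : t1 <= t <= t2 by rewrite in_itv in tI.
have /andP[h1 h2] := ht.
have tT : t < T by exact: le_lt_trans t2T.
suff fa : - (tau t1 * (al * r + 1)) <= f (a, t).
  have : f (a, t) <= f (x, t2) by apply: minf; rewrite inE; split => //=; rewrite in_itv/= t12 lexx.
  by move=> h; have := le_trans fa h; rewrite /f/= lerBrDr [- _ + _]addrC.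
move: h1; rewrite le_eqVlt => /predU1P[<-|h1].
  rewrite /f/= tint_self sub0r lerN2; apply: ler_wpM2l.
    by rewrite ltW// profile_gt0// (le_lt_trans t12).
  by rewrite lerD2r ler_wpM2l// ltW.
exfalso.
have tau0 : 0 < tau t by exact: profile_gt0.
have ua : 2 * N%:R * al * tau t <= u a t.
  have [arE|arN] := eqVneq (dotv a a) r; first exact: Hb.
  have arL : dotv a a < r by rewrite lt_neqAle arN.
  have [z z0 hz] := dotv_nbhs arL.
  have ga : 2 * N%:R * (al * tau t) <= g t a.
    apply: (@touching_below R N a z (al * tau t) (W m t) (g t)) => //.
    - exact: (@continuous_tint R N _ (continuous_upow hw t10 t12 t2T m0) t1 t).
    - exact: continuous_g.
    - move=> z' /andP[z'0 _]; exact: (weak_identity m0 p0 sigma0 hw t10 t12 t2T a z'0 tI).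
    - move=> y /hz yr; have : f (a, t) <= f (y, t).
        by apply: minf; rewrite inE; split => //=; exact: ltW.
      rewrite /f/=; move: (W m t a) (W m t y) (dotv a a) (dotv y y) (tau t) => A B C D E.
      by lra.
  (* Both terms subtracted from u(a,t) in [g t a] are nonnegative, so u(a,t) inherits the lower
     bound. *)
  apply: (@le_trans _ _ (g t a)); first by rewrite -mulrA.
  have t1I : t1 \in `[t1, t2] by rewrite in_itv/= lexx.
  have ut1 := u_ge0 a t1I.
  have : 0 <= enorm a `^ sigma * W p t a by rewrite mulr_ge0 ?powR_ge0 ?tint_upow_ge0.
  by lra.
have dW := is_derive_tint (continuous_upow hw t10 t12 t2T m0) a h1.
have dP := is_derive_profile km tT.
have dD := is_derive_funB dW (is_derive_funM dP (is_derive_fun_cst t (1 : R) (al * dotv a a + 1))).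
have := left_min_derive_le0 h1 dD.
have minD s : s \in `[t1, t] -> f (a, t) <= f (a, s).
  rewrite in_itv/= => /andP[s1 s2]; apply: minf; rewrite inE; split => //=.
  by rewrite in_itv/= s1 (le_trans s2).
move=> /(_ minD); apply/negP; rewrite -ltNge.
rewrite (upowE hw t10 t2T _ _ tI) mulr0 add0r.
have ut : (2 * N%:R * al) `^ m * tau t `^ m <= u a t `^ m.
  have c0 : 0 <= 2 * N%:R * al by rewrite mulr_ge0 ?mulr_ge0// ltW.
  rewrite -powRM// ?(ltW tau0)//; apply: (ge0_ler_powR (ltW m0)) => //.
    by rewrite nnegrE mulr_ge0// ltW.
  by rewrite nnegrE u_ge0.
have taum : 0 < tau t `^ m by rewrite powR_gt0.
have har : kappa * (al * dotv a a + 1) <= kappa * (al * r + 1).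
  by rewrite ler_wpM2l ?(ltW k0)// lerD2r ler_wpM2l ?(ltW al0).
rewrite -/(tau t) subr_gt0; apply: lt_le_trans ut.
rewrite mulrA [_ * kappa]mulrC ltr_pM2r//.
exact: le_lt_trans har hal.
Qed.

End comparison.

Lemma powR_interpolation (R : realType) (p m eps : R) : 0 < p -> p < m -> 0 < eps ->
  exists2 C : R, 0 <= C & forall v, 0 <= v -> v `^ p <= eps * v `^ m + C.
Proof.
move=> p0 pm eps0; have q0 : 0 < m - p by rewrite subr_gt0.
(* Threshold where eps v^(m-p) = 1: above it v^p <= eps v^m, below it v^p <= k^p. *)
pose k := (eps^-1) `^ (m - p)^-1.
exists (k `^ p); first exact: powR_ge0.
move=> v v0; have [vk|kv] := leP v k.
  apply: (@le_trans _ _ (k `^ p)); last by rewrite lerDr mulr_ge0 ?powR_ge0// ltW.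
  by apply: (ge0_ler_powR (ltW p0)) => //; rewrite nnegrE powR_ge0.
have vp : 0 < v by apply: le_lt_trans kv; exact: powR_ge0.
apply: (@le_trans _ _ (eps * v `^ m)); last by rewrite lerDl powR_ge0.
have -> : v `^ m = v `^ p * v `^ (m - p).
  by rewrite -powRD ?subrKC// (gt_eqF vp) implybT.
rewrite mulrCA ler_peMr ?powR_ge0// -ler_pdivrMl// mulr1.
have -> : eps^-1 = k `^ (m - p).
  by rewrite -powRrM mulVf ?gt_eqF// powRr1// invr_ge0 ltW.
by apply: (ge0_ler_powR (ltW q0)); rewrite ?nnegrE ?powR_ge0 ?ltW.
Qed.

(** * Upper bound for W from a bound on a larger sphere *)

Section outer_bound.
Variables (R : realType) (N : nat) (m p sigma T : R).
Variables (u0 : 'rV[R]_N -> R) (u : 'rV[R]_N -> R -> R).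
Hypotheses (m0 : 0 < m) (p0 : 0 < p) (sigma0 : 0 < sigma).
Hypothesis hw : weak_solution m p sigma u0 T u.
Variables t1 t2 : R.
Hypotheses (t10 : 0 < t1) (t12 : t1 <= t2) (t2T : t2 < T).
Local Notation lambda := (@lebesgue_measure R).
Local Notation W r := (tint (upow u t1 t2 r) t1).
Local Notation g t := (fun x => u x t - u x t1 - enorm x `^ sigma * W p t x).

Lemma integrable_upow r x : 0 < r -> lambda.-integrable `[t1, t2] (EFin \o upow u t1 t2 r x).
Proof. by move=> r0; exact: (integrable_time_section (continuous_upow hw t10 t12 t2T r0)). Qed.

Lemma integrable_cst_itv (c : R) : lambda.-integrable `[t1, t2] (EFin \o (fun=> c)).
Proof.
apply: continuous_compact_integrable; first exact: segment_compact.
by apply: continuous_subspaceT; exact: cont_cst.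
Qed.

Lemma Rintegral_cst_itv (c : R) : \int[lambda]_(s in `[t1, t2]) c = c * (t2 - t1).
Proof.
have E : fine (lambda `[t1, t2]%classic) = t2 - t1.
  rewrite lebesgue_measure_itv/= lte_fin.
  by move: t12 => h12; case: ifPn => h; [rewrite -EFinB|rewrite /=; lra].
by rewrite Rintegral_cst//; congr (_ * _); exact: E.
Qed.

Lemma time_length : t2 - t1 <= T.
Proof. by move: t10 t2T => h1 h2; lra. Qed.

Lemma tint_upow_le_cst x M : 0 <= M -> (forall s, s \in `[t1, t2] -> u x s <= M) ->
  W m t2 x <= M `^ m * T.
Proof.
move=> M0 H; apply: (@le_trans _ _ (\int[lambda]_(s in `[t1, t2]) (M `^ m))).
  apply: le_Rintegral => //; [exact: integrable_upow|exact: integrable_cst_itv|].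
  move=> s sI; rewrite (upowE hw t10 t2T _ _ sI).
  apply: (ge0_ler_powR (ltW m0)) => //; last exact: H.
  by rewrite nnegrE; exact: (u_ge0 hw t10 t2T _ sI).
by rewrite Rintegral_cst_itv ler_wpM2l ?powR_ge0// time_length.
Qed.

Lemma tint_upow_interp x eps C : 0 <= C ->
  (forall v, 0 <= v -> v `^ p <= eps * v `^ m + C) ->
  W p t2 x <= eps * W m t2 x + C * T.
Proof.
move=> C0 H.
have mI : measurable (`[t1, t2]%classic : set (measurableTypeR R)) by exact: measurable_itv.
have im := integrable_upow x m0.
have iem : lambda.-integrable `[t1, t2] (EFin \o (fun s => eps * upow u t1 t2 m x s)).
  by have := integrableZl mI eps im; apply: eq_integrable => // s _ /=; rewrite EFinM.
have iemc : lambda.-integrable `[t1, t2] (EFin \o (fun s => eps * upow u t1 t2 m x s + C)).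
  by have := integrableD mI iem (integrable_cst_itv C); apply: eq_integrable.
apply: (@le_trans _ _ (\int[lambda]_(s in `[t1, t2]) (eps * upow u t1 t2 m x s + C))).
  apply: le_Rintegral => //; first exact: integrable_upow.
  by move=> s _; apply: H; rewrite le_max lexx.
rewrite RintegralD//; last exact: integrable_cst_itv.
rewrite RintegralZl// lerD2l Rintegral_cst_itv ler_wpM2l//; exact: time_length.
Qed.

(** The concavity [A] depends on the unknown maximum X of W, since the source term is bounded only
    through X. The coefficient N / (r r^(sigma/2)) in the interpolation is chosen so that A r
    contains exactly X / 2, which is absorbed on the left; this accounts for the factor 2. The bound
    does not involve t2, as the passage t2 -> T requires. *)
Lemma outer_bound r M K0 C : (0 < N)%N -> 0 < r -> 0 <= M -> 0 <= C -> 0 <= K0 ->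
  (exists x1 : 'rV[R]_N, dotv x1 x1 = r) ->
  (forall x s, s \in `[t1, t2] -> dotv x x = r -> u x s <= M) ->
  (forall x, dotv x x <= r -> u x t1 <= K0) ->
  (forall v, 0 <= v -> v `^ p <= N%:R / (r * Num.sqrt r `^ sigma) * v `^ m + C) ->
  forall x, dotv x x <= r -> W m t2 x <=
    2 * (M `^ m * T + r * (K0 + Num.sqrt r `^ sigma * (C * T) + 1) / (2 * N%:R)).
Proof.
move=> N0 r0 M0 C0 K00 [x1 x1r] HM HK HC x xr.
have n0 : 0 < N%:R :> R by rewrite ltr0n.
set rs := Num.sqrt r `^ sigma in HC *.
have rs0 : 0 < rs by rewrite powR_gt0// sqrtr_gt0.
have cW := @continuous_tint R N _ (continuous_upow hw t10 t12 t2T m0) t1 t2.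
pose B := [set x : 'rV[R]_N | dotv x x <= r].
have cB : compact B by exact: compact_ball_dotv.
have B0 : B !=set0 by exists x1; rewrite /B/= x1r.
have [b bB maxb] := EVT_max_rV B0 cB (continuous_subspaceT cW).
set X := W m t2 b in maxb.
have X0 : 0 <= X by exact: tint_upow_ge0.
have t2I : t2 \in `[t1, t2] by rewrite in_itv/= t12 lexx.
pose K := K0 + rs * (C * T).
(* At an interior maximum of W + A |x|^2 one has g >= - (K + N X / r), whereas touching from above
   gives g <= - 2 N A; the summand 1 makes these incompatible. The maximum is therefore on the
   sphere. *)
pose A := (K + N%:R / r * X + 1) / (2 * N%:R).
pose f x := W m t2 x + A * dotv x x.
have cf : continuous f.
  by apply: contD => //; apply: contM; [exact: cont_cst|exact: continuous_dotv].
have [a aB maxf] := EVT_max_rV B0 cB (continuous_subspaceT cf).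
have ar : dotv a a <= r by move: aB; rewrite inE.
have A2 : 2 * N%:R * A = K + N%:R / r * X + 1.
  by rewrite /A; field; rewrite !gt_eqF.
have aE : dotv a a = r.
  apply/eqP/negPn/negP => arN.
  have arL : dotv a a < r by rewrite lt_neqAle arN.
  have [z z0 hz] := dotv_nbhs arL.
  have ga : g t2 a <= 2 * N%:R * (- A).
    apply: (@touching_above R N a z (- A) (W m t2) (g t2)) => //.
    - exact: (continuous_g p0 sigma0 hw t10 t12 t2T t2I).
    - move=> z' /andP[z'0 _]; exact: (weak_identity m0 p0 sigma0 hw t10 t12 t2T a z'0 t2I).
    - move=> y /hz yr; rewrite !mulNr !opprK; apply: maxf; rewrite inE; exact: ltW.
  have uat2 := u_ge0 hw t10 t2T a t2I.
  have uat1 := HK a ar.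
  have WX : W m t2 a <= X by apply: maxb; rewrite inE.
  have PX := tint_upow_interp a C0 HC.
  have ea : enorm a `^ sigma <= rs.
    apply: (ge0_ler_powR (ltW sigma0)); rewrite ?nnegrE ?sqrtr_ge0//.
    by rewrite ler_wsqrtr.
  have P0 : 0 <= W p t2 a by exact: tint_upow_ge0.
  have SP : enorm a `^ sigma * W p t2 a <= rs * (N%:R / (r * rs) * X + C * T).
    have eps0 : 0 <= N%:R / (r * rs) by rewrite divr_ge0 ?mulr_ge0// ltW.
    have PX' : W p t2 a <= N%:R / (r * rs) * X + C * T.
      move: PX WX; move: (W p t2 a) (W m t2 a) => q1 q2 PX WX.
      by apply: le_trans PX _; rewrite lerD2r ler_wpM2l.
    exact: (ler_pM (powR_ge0 _ _) P0 ea PX').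
  have EX : rs * (N%:R / (r * rs) * X + C * T) = N%:R / r * X + rs * (C * T).
    by field; rewrite !gt_eqF.
  move: ga; rewrite mulrN A2 /K; rewrite EX in SP; lra.
have WM : W m t2 a <= M `^ m * T by apply: tint_upow_le_cst => // s sI; exact: HM.
have fb : f b <= f a := maxf b bB.
have A0 : 0 <= A.
  have T0 : 0 <= T by rewrite (le_trans (ltW t10))// (le_trans t12)// ltW.
  have K1 : 0 <= K by apply: addr_ge0 => //; apply: mulr_ge0; [exact: ltW|exact: mulr_ge0].
  have rX : 0 <= N%:R / r * X by apply: mulr_ge0 => //; apply: divr_ge0; exact: ltW.
  apply: divr_ge0; last by apply: mulr_ge0 => //; exact: ltW.
  by apply: addr_ge0 => //; exact: addr_ge0.
have fbX : X <= f b.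
  have := sqd_ge0 0 b; rewrite /sqd subr0 => b0.
  by rewrite /f lerDl mulr_ge0.
have Ar : A * r = r * (K0 + rs * (C * T) + 1) / (2 * N%:R) + X / 2.
  by rewrite /A /K; field; rewrite !gt_eqF.
apply: (@le_trans _ _ X); first by apply: maxb; rewrite inE.
have fa : f a = W m t2 a + A * r by rewrite /f aE.
rewrite fa Ar in fb.
move: fb fbX WM; move: (f b) (W m t2 a) (M `^ m * T) (_ / (2 * N%:R)) => q1 q2 q3 q4.
by lra.
Qed.

End outer_bound.

(** * From a point that is not a blow-up point to the contradiction *)

Lemma not_blowup_bounded (R : realType) N (u : 'rV[R]_N -> R -> R) T x : 0 < T ->
  ~ blowup_point u T x ->
  exists M d, 0 < d /\ forall t, 0 < t < T -> T - d < t -> u x t <= M.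
Proof.
move=> T0 nb; apply: contrapT => H; apply: nb.
have ex k : exists t, [/\ 0 < t < T, T - k.+1%:R^-1 < t & k%:R < u x t].
  apply: contrapT => n; apply: H; exists k%:R, k.+1%:R^-1; split; first by rewrite invr_gt0.
  move=> t tT Tt; rewrite leNgt; apply/negP => ut; apply: n; by exists t.
pose ts k := sval (cid (ex k)).
have tsP k : [/\ 0 < ts k < T, T - k.+1%:R^-1 < ts k & k%:R < u x (ts k)] by rewrite /ts; case: cid.
(* Space is kept constant along the sequence, so the lemma bounds u at the point x alone; radial
   symmetry later extends the bound to the sphere through it. *)
exists (fun=> x), ts; split.
- by move=> k; have [] := tsP k.
- exact: cvg_cst.
- apply: (@squeeze_cvgr _ _ _ _ (fun k => T - k.+1%:R^-1) (fun=> T)).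
  + by apply: nearW => k; have [/andP[_ /ltW ->] /ltW ->] := tsP k.
  + rewrite -[X in _ --> X]subr0; apply: cvgB; first exact: cvg_cst.
    exact: cvg_harmonic.
  + exact: cvg_cst.
- apply: (@ger_cvgy _ _ _ _ (fun k => k%:R)); last exact: cvgr_idn.
  by apply: nearW => k; have [_ _ /ltW] := tsP k.
Qed.

(** With b = k (r + 1) + 1 and al = b^(1/(m-1)) >= 1 one has al^m = al b, and k (al r + 1) <= al k
    (r + 1) < al b. Thus m > 1 makes the right side win for large al. *)
Lemma exists_supersolution_slope (R : realType) N (m k r : R) : (0 < N)%N ->
  1 < m -> k = (m - 1)^-1 -> 0 <= r ->
  exists2 al : R, 0 < al & k * (al * r + 1) < (2 * N%:R * al) `^ m.
Proof.
move=> N0 m1 kE r0.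
have k0 : 0 < k by rewrite kE invr_gt0 subr_gt0.
pose b := k * (r + 1) + 1.
have b1 : 1 <= b by rewrite lerDr mulr_ge0 ?addr_ge0// ltW.
have b0 : 0 < b by exact: lt_le_trans b1.
pose al := b `^ k.
have al1 : 1 <= al.
  by have := ge0_ler_powR (ltW k0) _ _ b1; rewrite powR1; apply; rewrite nnegrE ?ltW.
have al0 : 0 < al by exact: lt_le_trans al1.
exists al => //.
have alm : al `^ m = al * b.
  rewrite -[m in LHS](subrKC 1) powRD; last by rewrite (gt_eqF al0) implybT.
  rewrite powRr1 ?ltW//; congr (_ * _).
  by rewrite /al -powRrM kE mulVf ?powRr1 ?ltW// gt_eqF// subr_gt0.
have n1 : 1 <= N%:R :> R by rewrite ler1n.
apply: (@lt_le_trans _ _ (al `^ m)).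
  rewrite alm /b.
  have : k <= k * al by rewrite ler_peMr// ltW.
  by nra.
have al2 : al <= 2 * N%:R * al by nra.
by apply: (ge0_ler_powR (le_trans ler01 (ltW m1))) => //; rewrite nnegrE ltW//; lra.
Qed.

Lemma enorm_sqr (R : realType) N (x : 'rV[R]_N) : enorm x ^+ 2 = dotv x x.
Proof.
by rewrite sqr_sqrtr//; have := sqd_ge0 0 x; rewrite /sqd subr0.
Qed.

Lemma enorm_eq (R : realType) N (x : 'rV[R]_N) (r : R) : 0 <= r ->
  dotv x x = r ^+ 2 -> enorm x = r.
Proof. by move=> r0 h; rewrite /enorm h sqrtr_sqr ger0_norm. Qed.

Theorem proposition3p2 (R : realType) (N : nat) (hN : (1 <= N)%N) (m r0 : R)
    (hm : 1 < m) (hr0 : 0 < r0) :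
  exists2 Cstar : R, 0 < Cstar &
  forall p sigma : R, 1 < p -> p < m -> 0 < sigma ->
  forall C0 : R, Cstar <= C0 ->
  forall u0 : 'rV[R]_N -> R,
    continuous u0 -> (forall x, 0 <= u0 x) -> radial u0 ->
    compact (closure [set x | u0 x != 0]) -> (exists x, u0 x != 0) ->
  forall (T : R) (u : 'rV[R]_N -> R -> R),
    weak_solution m p sigma u0 T u ->
    (forall t, 0 < t < T -> radial (u ^~ t)) ->
    blowup_time u T ->
    (forall x, enorm x = r0 -> blowup_point u T x) ->
    (exists2 l : \bar R, (C0%:E <= l)%E &
      forall x, enorm x = r0 ->
        (((T - t) `^ (m - 1)^-1 * u x t)%:E @[t --> T^'-] --> l)) ->
  blowup_set u T = setT.
Proof.
have m1 : 0 < m - 1 by rewrite subr_gt0.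
pose kappa := (m - 1)^-1.
have k0 : 0 < kappa by rewrite invr_gt0.
have km : kappa * m = kappa + 1 by rewrite /kappa; field; rewrite gt_eqF.
have m0 : 0 < m by exact: lt_trans hm.
have r2 : 0 < r0 ^+ 2 by exact: exprn_gt0.
have [al al0 hal] := exists_supersolution_slope hN hm (erefl kappa) (ltW r2).
have n0 : 0 < N%:R :> R by rewrite ltr0n.
set c := 2 * N%:R * al in hal.
have c0 : 0 < c by rewrite mulr_gt0 ?mulr_gt0.
(* [al] was obtained from N, m and r0 alone, before p, sigma and the solution. The summand 1 makes
   the limit exceed c strictly, so that u > c tau on the sphere for all times close to T. *)
exists (c + 1); first exact: addr_gt0.
move=> p sigma p1 pm sigma0 C0 hC u0 _ _ _ _ _ T u hw hrad [T0 _ _] hb [l hl hlim].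
have p0 : 0 < p by exact: lt_trans p1.
apply/seteqP; split => // x0 _; apply: contrapT => nb.
have [M [d [d0 Hd]]] := not_blowup_bounded T0 nb.
pose x1 : 'rV[R]_N := r0 *: basis_vec R (Ordinal hN).
have x1r : dotv x1 x1 = r0 ^+ 2.
  have x1E i : x1 ord0 i = r0 * (i == Ordinal hN)%:R by rewrite !mxE eqxx.
  rewrite /dotv (bigD1 (Ordinal hN))//= big1 => [|i /negbTE iN]; rewrite x1E.
    by rewrite eqxx mulr1 addr0.
  by rewrite iN mulr0 mul0r.
have ex1 : enorm x1 = r0 by apply: enorm_eq => //; exact: ltW.
have near_T : \forall t \near T^'-, c < (T - t) `^ kappa * u x1 t.
  have cl : (c%:E < l)%E by apply: lt_le_trans hl; rewrite lte_fin (lt_le_trans _ hC)// ltrDl.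
  have : \forall t \near T^'-, (c%:E < ((T - t) `^ (m - 1)^-1 * u x1 t)%:E)%E :=
    hlim x1 ex1 _ (open_nbhs_nbhs (conj (@open_ereal_gt_ereal R c%:E) cl)).
  by apply: filterS => t; rewrite lte_fin.
have [e e0 He] : exists2 e, 0 < e & forall t, T - e < t < T -> c < (T - t) `^ kappa * u x1 t.
  have /nbhs_ballP[e /= e0 He] := near_T; exists e => // t /andP[h1 h2]; apply: He => //.
  by rewrite /ball/= ger0_norm; lra.
(* Close enough to T that t1 > 0, that u(x0, .) is bounded from t1 on, and that the rate on the
   sphere holds from t1 on. *)
pose t1 := T - Num.min (T / 2) (Num.min (d / 2) (e / 2)).
have t10 : 0 < t1.
  have : Num.min (T / 2) (Num.min (d / 2) (e / 2)) <= T / 2 by rewrite ge_min lexx.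
  by rewrite /t1; move: (Num.min _ _) => q h; lra.
have t1d : T - d < t1.
  have : Num.min (T / 2) (Num.min (d / 2) (e / 2)) <= d / 2 by rewrite !ge_min lexx orbT.
  by rewrite /t1; move: (Num.min _ _) => q h; lra.
have t1e : T - e < t1.
  have : Num.min (T / 2) (Num.min (d / 2) (e / 2)) <= e / 2 by rewrite !ge_min lexx !orbT.
  by rewrite /t1; move: (Num.min _ _) => q h; lra.
have t1T : t1 < T by rewrite /t1 gtrBl !lt_min !divr_gt0.
have tin t2 s : t2 < T -> s \in `[t1, t2] -> 0 < s < T.
  by rewrite in_itv/= => t2T /andP[h1 h2]; rewrite (lt_le_trans t10 h1) (le_lt_trans h2 t2T).
have lowb t2 x s : t2 < T -> s \in `[t1, t2] -> dotv x x = r0 ^+ 2 ->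
    2 * N%:R * al * profile T kappa s <= u x s.
  move=> t2T sI xr; have sT := tin t2 s t2T sI.
  have ex : enorm x = enorm x1 by rewrite ex1; apply: enorm_eq => //; exact: ltW.
  rewrite (hrad s sT x x1 ex) -/c /profile powRN.
  have /andP[_ sT'] := sT.
  rewrite ler_pdivrMr ?powR_gt0 ?subr_gt0// mulrC; apply/ltW/He.
  by move: sI; rewrite in_itv/= => /andP[h1 h2]; rewrite sT' andbT; exact: lt_le_trans h1.
have comp t2 x : t1 <= t2 -> t2 < T -> dotv x x <= r0 ^+ 2 ->
    profile T kappa t2 * (al * dotv x x + 1) - profile T kappa t1 * (al * r0 ^+ 2 + 1)
    <= tint (upow u t1 t2 m) t1 t2 x.
  move=> t12 t2T xr.
  apply: (inner_comparison m0 p0 sigma0 hw t10 t12 t2T al0 km k0 hal (ltW r2)) => //.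
    by exists x1.
  by move=> y s sI; exact: lowb t2T sI.
pose M' := Num.max 0 M.
have M'0 : 0 <= M' by rewrite le_max lexx.
have ux0 t2 s : t2 < T -> s \in `[t1, t2] -> u x0 s <= M'.
  move=> t2T sI; have sT := tin t2 s t2T sI.
  rewrite le_max; apply/orP; right; apply: Hd => //.
  by move: sI; rewrite in_itv/= => /andP[h1 h2]; exact: lt_le_trans h1.
(* The lower barrier is at least tau(t2) minus a constant independent of t2, so no bound on W at a
   point of the closed ball can be uniform in t2. *)
have large B x : dotv x x <= r0 ^+ 2 ->
    (forall t2, t1 <= t2 -> t2 < T -> tint (upow u t1 t2 m) t1 t2 x <= B) -> False.
  move=> xr HB.
  have [t2 /andP[t12 t2T] Ht2] := @profile_unbounded R T kappa
    (B + profile T kappa t1 * (al * r0 ^+ 2 + 1)) t1 k0 t1T.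
  have := le_trans (comp t2 x t12 t2T xr) (HB t2 t12 t2T).
  have tau0 : 0 < profile T kappa t2 by exact: profile_gt0.
  have q0 : 0 <= al * dotv x x by rewrite mulr_ge0 ?(ltW al0)// -enorm_sqr sqr_ge0.
  move: (profile T kappa t2) tau0 Ht2 => tau tau0 Ht2.
  move: (profile T kappa t1 * _) Ht2 => q1 Ht2.
  by move: (al * dotv x x) q0 => q q0; nra.
(* Within the ball the contradiction arises at [x0] itself. Outside, it arises at [x1], on the
   sphere of radius r0, which the larger ball through [x0] contains. *)
have [x0r|x0r] := leP (dotv x0 x0) (r0 ^+ 2).
  apply: (large (M' `^ m * T) x0 x0r) => t2 t12 t2T.
  apply: (tint_upow_le_cst m0 hw t10 t12 t2T) => // s sI; exact: ux0 sI.
pose r := dotv x0 x0; have rp : 0 < r by exact: lt_trans r2 _.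
have cu1 : continuous (u ^~ t1).
  by apply: (continuous_uslice hw t10 (lexx t1) t1T); rewrite in_itv/= lexx.
have B0 : [set x : 'rV[R]_N | dotv x x <= r] !=set0 by exists x0; rewrite /= /r.
have [b _ maxb] := EVT_max_rV B0 (@compact_ball_dotv R N r) (continuous_subspaceT cu1).
pose K0 := Num.max 0 (u b t1).
have eps0 : 0 < N%:R / (r * Num.sqrt r `^ sigma).
  by rewrite divr_gt0// mulr_gt0// powR_gt0// sqrtr_gt0.
have [C C0' HC] := powR_interpolation p0 pm eps0.
apply: (large _ x1 _) => [|t2 t12 t2T]; first by rewrite x1r.
apply: (outer_bound m0 p0 sigma0 hw t10 t12 t2T hN rp M'0 C0' (_ : 0 <= K0) _ _ _ HC).
- by rewrite le_max lexx.
- by exists x0.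
- move=> x s sI xr; have sT := tin t2 s t2T sI.
  have -> : u x s = u x0 s by apply: (hrad s sT); rewrite /enorm xr.
  exact: ux0 sI.
- by move=> x xr; rewrite le_max; apply/orP; right; apply: maxb; rewrite inE.
- by rewrite x1r ltW.
Qed.
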